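(* Let $N\geq 2$, $p>1$, let $\Omega\subset\mathbb{R}^N$ be a bounded and smooth domain and let $v\in W_0^{1,p}(\Omega)$. Then $v\in\mathcal{M}(\Omega)$ if, and only if, $$\int_\Omega\log|v|\,dx=0.$$ In particular, $\int_\Omega\log|u|\,dx=0$, where $u$ is the weak solution of $$-\Delta_p w=\frac{\mu(\Omega)}{|\Omega|}w^{-1}\ \text{in }\Omega,\qquad w>0\ \text{in }\Omega,\qquad w=0\ \text{on }\partial\Omega.$$
   Context: $|\Omega|$ denotes the $N$-dimensional Lebesgue measure of $\Omega$, $\|\cdot\|_p$ the norm of $L^p(\Omega)$, and $\Delta_p v=\operatorname{div}(|\nabla v|^{p-2}\nabla v)$. For $q\in(0,1)$, $$\lambda_q(\Omega):=\inf\left\{\|\nabla v\|_p^p : v\in W_0^{1,p}(\Omega)\ \text{and}\ \int_\Omega |v|^q\,dx=1\right\},\qquad \mu(\Omega):=\lim_{q\to0^+}\lambda_q(\Omega)|\Omega|^{p/q}\in(0,\infty).$$ $$\mathcal{M}(\Omega):=\left\{v\in W_0^{1,p}(\Omega):\lim_{q\to0^+}\left(\frac1{|\Omega|}\int_\Omega|v|^q\,dx\right)^{1/q}=1\right\}$$ (the limit exists for every $v\in L^1(\Omega)$, by monotonicity in $q$). Integrals $\int_\Omega\log|v|\,dx$ with $v\in L^1(\Omega)$ take values in $[-\infty,\infty)$, with $\log 0=-\infty$. For $\lambda>0$, a weak solution of $-\Delta_p w=\lambda w^{-1}$ in $\Omega$, $w>0$ in $\Omega$, $w=0$ on $\partial\Omega$,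 is a function $w\in W_0^{1,p}(\Omega)$ with $\operatorname{ess\,inf}_K w>0$ for each compact $K\subset\Omega$ and $\int_\Omega|\nabla w|^{p-2}\nabla w\cdot\nabla\varphi\,dx=\lambda\int_\Omega w^{-1}\varphi\,dx$ for all $\varphi\in W_0^{1,p}(\Omega)$. For $\lambda=\mu(\Omega)/|\Omega|$ such a solution exists and is unique. *)

(* Defs.v *)
From HB Require Import structures.
From mathcomp Require Import all_boot all_order all_algebra.
From mathcomp Require Import all_classical all_reals all_analysis.
From mathcomp Require Import ess_sup_inf hoelder.

Set Implicit Arguments.
Unset Strict Implicit.
Unset Printing Implicit Defensive.

Import Order.TTheory GRing.Theory Num.Theory.
Import numFieldNormedType.Exports.

Local Open Scope classical_set_scope.
Local Open Scope ring_scope.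

(* R^N is 'rV[R]_N, with the library topology (that of the sup norm); its Borel
   sigma-algebra is presented as the product of those of the factors, as the
   library does for tuples. *)
Definition rV_display : measure_display.
Proof. exact: default_measure_display. Qed.

Section measurable_rV.
Context {R : realType} (n : nat).

Let coors : 'I_n -> 'rV[R]_n -> measurableTypeR R := fun i x => x ord0 i.

Let rV_set0 : g_sigma_preimage coors set0.
Proof. exact: sigma_algebra0. Qed.

Let rV_setC A : g_sigma_preimage coors A -> g_sigma_preimage coors (~` A).
Proof. exact: sigma_algebraC. Qed.

Let rV_bigcup (F : _^nat) : (forall i, g_sigma_preimage coors (F i)) ->
  g_sigma_preimage coors (\bigcup_i (F i)).
Proof. exact: sigma_algebra_bigcup. Qed.

HB.instance Definition _ := @isMeasurable.Build rV_display
  'rV[R]_n (g_sigma_preimage coors) rV_set0 rV_setC rV_bigcup.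

Lemma measurable_coord (i : 'I_n) :
  measurable_fun [set: 'rV[R]_n]
    (fun x : 'rV[R]_n => x ord0 i : measurableTypeR R).
Proof.
move=> _ Y mY; rewrite setTI; apply: sub_sigma_algebra => /=.
rewrite -bigcup_seq/=; exists i => /=; first by rewrite mem_index_enum.
by exists Y => //; rewrite setTI.
Qed.

Lemma measurable_fun_coordP d (T : measurableType d) (f : T -> 'rV[R]_n) :
  (forall i, measurable_fun [set: T] (fun x => f x ord0 i : measurableTypeR R)) ->
  measurable_fun [set: T] f.
Proof.
move=> mf; suff H : g_sigma_preimage coors `<=`
    [set A | measurable (f @^-1` A)].
  by move=> _ A mA; rewrite setTI; exact: H.
apply: smallest_sub.
  split => //=.
  - by rewrite preimage_set0.
  - by move=> A mA; rewrite setTD preimage_setC; exact: measurableC.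
  - by move=> F mF; rewrite preimage_bigcup; exact: bigcup_measurable.
move=> A; rewrite -bigcup_seq => -[i _ [B mB <-]] /=.
by have := mf i measurableT B mB; rewrite !setTI.
Qed.

End measurable_rV.

Section lebesgue.
Context {R : realType}.

Definition rV_cons n (x : 'rV[R]_n * measurableTypeR R) : 'rV[R]_n.+1 :=
  row_mx (x.2%:M : 'rV[R]_1) x.1.

Lemma measurable_rV_cons n : measurable_fun setT (@rV_cons n).
Proof.
apply: measurable_fun_coordP => i; rewrite /rV_cons.
have [j ->|j ->] := split_ordP (i : 'I_(1 + n)).
  apply: (eq_measurable_fun snd) => //= x _.
  by rewrite (@row_mxEl _ 1 1 n) (ord1 j) mxE eqxx mulr1n.
apply: (eq_measurable_fun (fun x : 'rV[R]_n * measurableTypeR R =>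
   x.1 ord0 j : measurableTypeR R)) => [x _|].
  by rewrite (@row_mxEr _ 1 1 n).
exact: measurableT_comp (@measurable_coord R n j) measurable_fst.
Qed.

(* N-dimensional Lebesgue measure, by iterated products of the one-dimensional
   one. *)
Fixpoint leb (n : nat) : {measure set 'rV[R]_n -> \bar R} :=
  match n with
  | 0 => dirac (0 : 'rV[R]_0)
  | m.+1 =>
    @measure_function_pushforward__canonical__measure_function_Measure _ _ _ _ _
      (leb m \x (@lebesgue_measure R))%E _ (@measurable_rV_cons m)
  end.

End lebesgue.

Section calculus.
Context {R : realType} (n : nat).
Implicit Types (f : 'rV[R]_n -> R) (x y : 'rV[R]_n) (Omega : set 'rV[R]_n).

Definition dot x y : R := \sum_(i < n) x ord0 i * y ord0 i.

(* `|x| is the sup norm of the row vector x. *)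
Definition enorm x : R := Num.sqrt (dot x x).

Definition partial (i : 'I_n) f : 'rV[R]_n -> R :=
  fun x => 'D_(delta_mx ord0 i) f x.

Definition grad f x : 'rV[R]_n := \row_i partial i f x.

Definition iter_partial (s : seq 'I_n) f : 'rV[R]_n -> R := foldr partial f s.

Definition smooth f := forall s : seq 'I_n,
  continuous (iter_partial s f) /\
  forall (i : 'I_n) x, derivable (iter_partial s f) x (delta_mx ord0 i).

Definition test_function Omega f :=
  [/\ smooth f, compact (closure [set x | f x != 0]) &
      closure [set x | f x != 0] `<=` Omega].

End calculus.

(* The boundary is locally a smooth graph, up to relabelling and reorienting
   the axes, with the domain on one side: near x0 the domain is
   { +/- x_i > gamma (x_j)_{j <> i} }. *)
Definition smooth_boundary {R : realType} (n : nat) (Omega : set 'rV[R]_n) :=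
  forall x0 : 'rV[R]_n, (closure Omega `\` interior Omega) x0 ->
  exists (r : R) (i : 'I_n) (b : bool) (gamma : 'rV[R]_n.-1 -> R),
    [/\ 0 < r, smooth gamma &
      forall x, enorm (x - x0) < r ->
        (Omega x <-> gamma (col' i x) < (-1) ^+ b * x ord0 i)].

Definition smooth_bounded_domain {R : realType} (n : nat)
    (Omega : set 'rV[R]_n) :=
  [/\ open Omega, connected Omega, Omega !=set0, bounded_set Omega &
      smooth_boundary Omega].

(* Elements of L^p(Omega) are represented by functions on R^n, of which only
   the values on Omega matter. *)
Section sobolev.
Context {R : realType} (n : nat) (p : R) (Omega : set 'rV[R]_n).
Implicit Types (v w phi : 'rV[R]_n -> R) (g : 'rV[R]_n -> 'rV[R]_n).

Definition in_Lp v := (v \_ Omega) \in Lfun (leb n) p%:E.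

Definition Lp_norm v : \bar R := 'N[leb n]_p%:E[EFin \o (v \_ Omega)].

Definition weak_gradient v g :=
  forall (i : 'I_n) phi, test_function Omega phi ->
  (\int[leb n]_(x in Omega) (v x * partial i phi x)%:E =
   - \int[leb n]_(x in Omega) (g x ord0 i * phi x)%:E)%E.

(* v is in W^{1,p}(Omega) and g is (a representative of) its gradient *)
Definition W1p v g :=
  [/\ in_Lp v, forall i, in_Lp (fun x => g x ord0 i) & weak_gradient v g].

(* W_0^{1,p}(Omega) is the closure of the test functions in W^{1,p}(Omega). *)
Definition W01p v g :=
  W1p v g /\
  exists phi : nat -> 'rV[R]_n -> R,
    [/\ forall k, test_function Omega (phi k),
        (fun k => Lp_norm (fun x => phi k x - v x)) @ \oo --> 0%E &
        (fun k => Lp_norm (fun x => enorm (grad (phi k) x - g x))) @ \oo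
          --> 0%E].

Definition in_W01p v := exists g, W01p v g.

Local Open Scope ereal_scope.

Definition lambda (q : R) : \bar R :=
  ereal_inf [set y | exists v g,
    [/\ W01p v g, \int[leb n]_(x in Omega) (`|v x| `^ q)%:E = 1 &
        y = \int[leb n]_(x in Omega) (enorm (g x) `^ p)%:E]].

Definition mu : \bar R :=
  lim ((fun q : R => lambda q * leb n Omega `^ (p / q)) @ 0^'+).

Definition calM : set ('rV[R]_n -> R) :=
  [set v | in_W01p v /\
    ((\int[leb n]_(x in Omega) (`|v x| `^ q)%:E) / leb n Omega) `^ q^-1
      @[q --> (0:R)^'+] --> 1].

(* lne 0 = -oo *)
Definition int_log v : \bar R := \int[leb n]_(x in Omega) lne `|v x|%:E.

Definition ess_inf_on (K : set 'rV[R]_n) w : \bar R :=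
  ess_inf (leb n) (patch (cst +oo) K (EFin \o w)).

(* Weak solutions of - Delta_p w = l / w, w > 0 in Omega, w = 0 on the boundary.
   As 0 `^ (p - 2) is finite, |g|^(p-2) g vanishes where g does, also for p < 2.
   The integrals are extended-real valued and the left one is finite, so for
   l > 0 the equation includes the integrability of phi / w on Omega. *)
Definition weak_solution (l : R) w :=
  exists g,
    [/\ W01p w g,
        forall K, compact K -> K `<=` Omega -> 0 < ess_inf_on K w &
        forall phi gphi, W01p phi gphi ->
          \int[leb n]_(x in Omega)
             (enorm (g x) `^ (p - 2) * dot (g x) (gphi x))%:E =
          l%:E * \int[leb n]_(x in Omega) ((w x)^-1 * phi x)%:E].

End sobolev.

(* Main.v *)
Require Import Defs.
From mathcomp Require Import all_boot all_order all_algebra.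
From mathcomp Require Import all_classical all_reals all_analysis.
From mathcomp Require Import measurable_realfun ess_sup_inf.
From mathcomp Require Import ring lra.
Set Implicit Arguments.
Unset Strict Implicit.
Unset Printing Implicit Defensive.
Import Order.TTheory GRing.Theory Num.Theory.
Import numFieldNormedType.Exports.
Local Open Scope classical_set_scope.
Local Open Scope ring_scope.

(** Write G(v) for the geometric mean exp((1/|Omega|) int_Omega log |v|), which
    is 0 when the integral is -oo.  For an integrable v the power means
    ((1/|Omega|) int_Omega |v|^q)^(1/q) converge to G(v) as q decreases to 0:
    by Jensen's inequality they are at least G(v), and by 1 + t <= e^t they are
    at most the exponential of the mean of (|v|^q - 1) / q, a function that
    decreases to log |v| (power_mean_cvg).  So v is in M(Omega) exactly when
    G(v) = 1, that is, when the integral of log |v| is 0.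

    For a weak solution u of - Delta_p u = l / u, the constant mu is computed
    from u: mu = l |Omega| G(u)^(-p).  With l = mu / |Omega| this says
    G(u) = 1.  The computation bounds lambda_q |Omega|^(p/q) on both sides.

    - From above, the multiple of u with normalized q-th power is a competitor,
      and testing the equation with u gives int |grad u|^p = l |Omega|.  The
      bound is l |Omega| M_q^(-p), where M_q is the power mean of u of order q
      (lambda_scaled_le).
    - From below, testing with psi >= 0 and using Young's inequality gives
      l int psi / u <= (1 - 1/p) l |Omega| + (1/p) int |grad psi|^p
      (weak_solution_test_le), while the weighted inequality between the
      arithmetic and the geometric mean bounds int psi^q by int psi / u and
      int u^r with r = q / (1 - q) (int_powR_le_mean).  When int psi^q is
      equal to |Omega| M_r^q, M_r being the power mean of u of order r, the two
      combine to l |Omega| <= int |grad psi|^p.  By density this holds for every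
      w in W_0^{1,p}(Omega) so normalized (weak_solution_minimal), and scaling
      turns it into the bound l |Omega| M_r^(-p) (lambda_scaled_ge).

    Both M_q and M_r tend to G(u).  If G(u) = 0 the lower bound forces
    mu = +oo, whose real part is 0 by convention; then l = 0, so grad u = 0, and
    u has mean zero (W01p_grad_eq0), against u > 0.

    In the density argument |w| is approached by sqrt(phi^2 + e^2) - e with phi
    a test function close to w: this is again a test function, and its gradient
    is at most that of phi.  That test functions belong to W_0^{1,p} is
    integration by parts, which comes down to int d_i F = 0 for a compactly
    supported F (integral_partial_eq0): Fubini's theorem and the fundamental
    theorem of calculus. *)

(** * Inequalities between real powers *)

Section real_inequalities.
Context {R : realType}.
Implicit Types x y t q : R.

Lemma powR_amgm x y t : 0 <= x -> 0 <= y -> 0 < t < 1 ->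
  x `^ t * y `^ (1 - t) <= t * x + (1 - t) * y.
Proof.
move=> x0 y0 /andP[t0 t1].
have u0 : 0 < 1 - t by rewrite subr_gt0.
have tV0 : 0 < t^-1 by rewrite invr_gt0.
have uV0 : 0 < (1 - t)^-1 by rewrite invr_gt0.
have := @conjugate_powR R (x `^ t) (y `^ (1 - t)) t^-1 (1 - t)^-1
  (powR_ge0 _ _) (powR_ge0 _ _) tV0 uV0.
rewrite !invrK -!powRrM !divff ?gt_eqF// !powRr1// => /(_ _)/le_trans; apply.
  by rewrite addrC subrK.
by rewrite mulrC (mulrC y).
Qed.

(** Concavity of y^t in y: its graph lies below the tangent at y = 1. *)
Lemma powR_bernoulli y t : 0 <= y -> 0 < t <= 1 -> y `^ t <= 1 + t * (y - 1).
Proof.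
move=> y0 /andP[t0]; rewrite le_eqVlt => /predU1P[->|t1].
  by rewrite powRr1// mul1r addrC subrK.
have := @powR_amgm y 1 t y0 ler01; rewrite t0 t1 powR1 mulr1 => /(_ isT)/le_trans.
by apply; rewrite le_eqVlt; apply/orP; left; apply/eqP; ring.
Qed.

(** Bernoulli's inequality for the number y^q2 and the exponent q1 / q2. *)
Lemma powR_quot_nondecreasing y q1 q2 : 0 <= y -> 0 < q1 -> q1 <= q2 ->
  (y `^ q1 - 1) / q1 <= (y `^ q2 - 1) / q2.
Proof.
move=> y0 q10 q12; have q20 : 0 < q2 by exact: lt_le_trans q12.
have t0 : 0 < q1 / q2 by rewrite divr_gt0.
have := @powR_bernoulli (y `^ q2) (q1 / q2) (powR_ge0 _ _).
rewrite t0 ler_pdivrMr// mul1r q12 => /(_ isT).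
rewrite -powRrM mulrCA divff ?gt_eqF// mulr1 => h.
by rewrite ler_pdivrMr// lerBlDl; apply: (le_trans h); rewrite lerD2l le_eqVlt; apply/orP;
  left; apply/eqP; ring.
Qed.

Lemma powR_subadditive x y q : 0 <= x -> 0 <= y -> 0 < q <= 1 ->
  (x + y) `^ q <= x `^ q + y `^ q.
Proof.
move=> x0 y0 /andP[q0 q1].
have [s0|s0] := eqVneq (x + y) 0.
  by rewrite s0 powR0 ?gt_eqF// addr_ge0// powR_ge0.
have sp : 0 < x + y by rewrite lt_neqAle eq_sym s0 addr_ge0.
have key z : 0 <= z <= x + y -> z / (x + y) * (x + y) `^ q <= z `^ q.
  move=> /andP[z0 zs]; have [->|zn0] := eqVneq z 0.
    by rewrite !mul0r powR_ge0.
  have zp : 0 < z / (x + y) by rewrite divr_gt0// lt_neqAle eq_sym zn0.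
  have zE : z = z / (x + y) * (x + y) by rewrite divfK.
  rewrite [leRHS](_ : _ = (z / (x + y)) `^ q * (x + y) `^ q); last first.
    by rewrite -powRM ?(ltW zp) ?(ltW sp)// divfK.
  rewrite ler_wpM2r ?powR_ge0// ger1_powR// zp ler_pdivrMr// mul1r //.
have := lerD (key x _) (key y _); rewrite x0 y0 lerDl y0 lerDr x0 => /(_ isT isT).
by rewrite -mulrDl -mulrDl divff// mul1r.
Qed.

(** The first term covers s <= eta and the second one s > eta; with eta chosen
    first, an L^p-small function has a small integral of its q-th power. *)
Lemma powR_le_split s q p eta : 0 <= s -> 0 < eta -> 0 < q -> q <= p ->
  s `^ q <= eta `^ q + eta `^ (q - p) * s `^ p.
Proof.
move=> s0 e0 q0 qp; have p0 : 0 < p by exact: lt_le_trans qp.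
have [se|es] := leP s eta.
  apply: ler_wpDr; first by rewrite mulr_ge0// powR_ge0.
  by apply: ge0_ler_powR => //; rewrite ?(ltW q0)// nnegrE// ltW.
apply: ler_wpDl; first exact: powR_ge0.
have sp : 0 < s by exact: lt_trans es.
have -> : s `^ q = s `^ (q - p) * s `^ p.
  by rewrite -powRD ?subrK//; apply/implyP => _; rewrite gt_eqF.
rewrite ler_wpM2r ?powR_ge0// -(opprB p q) !powRN.
rewrite lef_pV2 ?posrE ?powR_gt0//.
by apply: ge0_ler_powR; rewrite ?subr_ge0// ?nnegrE// ltW.
Qed.

End real_inequalities.

Section measurability.
Context d (T : measurableType d) {R : realType} (D : set T) (f : T -> R).
Hypothesis mf : measurable_fun D f.

Lemma measurable_fun_powR (q : R) : measurable_fun D (fun x => f x `^ q).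
Proof.
exact: (@measurableT_comp _ _ _ _ _ _ (fun y => y `^ q) _ _ (measurable_powR q) mf).
Qed.

Lemma measurable_fun_inv_norm : measurable_fun D (fun x => `|f x|^-1).
Proof.
have mnf : measurable_fun D (fun x => `|f x|) by exact: measurableT_comp.
rewrite (_ : (fun _ => _) = fun x => `|f x| `^ (-1)).
  exact: (@measurableT_comp _ _ _ _ _ _ (fun y => y `^ (-1)) _ _ (measurable_powR (-1)) mnf).
by apply/funext => x; rewrite powR_inv1.
Qed.

Lemma measurable_fun_inv : measurable_fun D (fun x => (f x)^-1).
Proof.
have mV := measurable_fun_inv_norm.
rewrite (_ : (fun _ => _) = fun x => f x * (`|f x|^-1 * `|f x|^-1)).
  by apply: measurable_funM => //; exact: measurable_funM.
apply/funext => x; rewrite -invfM -expr2 real_normK ?num_real//.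
have [->|fx0] := eqVneq (f x) 0; first by rewrite invr0 mul0r.
by field.
Qed.

End measurability.

(** * Power means and the geometric mean *)

Lemma integral_EFin d (T : measurableType d) {R : realType}
    (m : {measure set T -> \bar R}) (D : set T) (g : T -> R) :
  measurable D -> m.-integrable D (EFin \o g) ->
  (\int[m]_(x in D) (g x)%:E)%E = (\int[m]_(x in D) g x)%:E.
Proof. by move=> mD ig; rewrite -[LHS]fineK// (integrable_fin_num mD ig). Qed.

Lemma integrableZl_EFin d (T : measurableType d) {R : realType}
    (m : {measure set T -> \bar R}) (D : set T) (k : R) (g : T -> R) :
  measurable D -> m.-integrable D (EFin \o g) ->
  m.-integrable D (EFin \o (fun x => k * g x)).
Proof. by move=> mD /(integrableZl mD k). Qed.

Section power_mean.
Context d (T : measurableType d) {R : realType}.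
Variables (m : {measure set T -> \bar R}) (D : set T) (a : R).
Hypotheses (mD : measurable D) (a0 : 0 < a) (mDa : m D = a%:E).

Lemma integrable_cst_fin (k : R) : m.-integrable D (EFin \o cst k).
Proof.
apply/integrableP; split; first exact/measurable_EFinP/measurable_cst.
by rewrite (integral_cst m mD `|k%:E|%E) mDa -EFinM ltry.
Qed.

Lemma Rintegral_cst_fin (k : R) : \int[m]_(x in D) k = k * a.
Proof. by rewrite Rintegral_cst// mDa. Qed.

Variable f : T -> R.
Hypotheses (f0 : forall x, D x -> 0 <= f x)
  (intf : m.-integrable D (EFin \o f)).

Let mf : measurable_fun D f.
Proof. exact/measurable_EFinP/measurable_int/intf. Qed.

Lemma integrable_powR (q : R) : 0 < q <= 1 ->
  m.-integrable D (EFin \o (fun x => f x `^ q)).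
Proof.
move=> /andP[q0 q1].
apply: (@le_integrable _ _ _ _ _ mD _ (EFin \o (fun x => 1 + f x))).
- by apply/measurable_EFinP; exact: measurable_fun_powR.
- move=> x Dx /=; rewrite lee_fin !ger0_norm ?addr_ge0 ?powR_ge0 ?f0//.
  have fx := f0 Dx; have := powR_bernoulli fx; move=> /(_ q); rewrite q0 q1 => /(_ isT).
  move=> /le_trans; apply; rewrite lerD2l.
  have [h|h] := leP 1 (f x).
    by rewrite (le_trans (ler_piMl _ q1)) ?subr_ge0// lerBlDr lerDl.
  by rewrite (le_trans _ fx)// mulr_ge0_le0 ?(ltW q0)// subr_le0 ltW.
- exact: (integrableD mD (integrable_cst_fin 1) intf).
Qed.

(** The mean of a function that decreases to log f as q decreases to 0. *)
Definition mean_quot (q : R) := \int[m]_(x in D) ((f x `^ q - 1) / q) / a.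

Lemma integrable_quot (q : R) : 0 < q <= 1 ->
  m.-integrable D (EFin \o (fun x => (f x `^ q - 1) / q)).
Proof.
move=> q01; rewrite (_ : _ \o _ = fun x => ((q^-1)%:E * (f x `^ q - 1)%:E)%E); last first.
  by apply/funext => x /=; rewrite -EFinM mulrC.
apply: integrableZl => //.
exact: (integrableB mD (integrable_powR q01) (integrable_cst_fin 1)).
Qed.

Lemma mean_quotE (q : R) : 0 < q <= 1 ->
  \int[m]_(x in D) (f x `^ q) / a = 1 + q * mean_quot q.
Proof.
move=> q01; have q0 : q != 0 by rewrite gt_eqF//; case/andP: q01.
rewrite /mean_quot RintegralZr//; last first.
  exact: (integrableB mD (integrable_powR q01) (integrable_cst_fin 1)).
rewrite RintegralB//; [|exact: integrable_powR|exact: integrable_cst_fin].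
by rewrite Rintegral_cst_fin; field; rewrite q0 gt_eqF.
Qed.

Lemma mean_quot_nondecreasing (q1 q2 : R) : 0 < q1 -> q1 <= q2 -> q2 <= 1 ->
  mean_quot q1 <= mean_quot q2.
Proof.
move=> q10 q12 q21; rewrite ler_pM2r ?invr_gt0//; apply: le_Rintegral => //.
- by apply: integrable_quot; rewrite q10 (le_trans q12).
- by apply: integrable_quot; rewrite q21 (lt_le_trans q10).
- by move=> x Dx; apply: powR_quot_nondecreasing => //; exact: f0.
Qed.

(** The gap between f - 1 and (f^q - 1) / q is nonnegative for q <= 1 and
    increases to f - 1 - log f as q decreases to 0, so that monotone convergence
    applies to it even where log f = -oo. *)
Let defect (q : R) x := (f x - 1) - (f x `^ q - 1) / q.
Let defect0 x : \bar R := ((f x - 1)%:E - lne (f x)%:E)%E.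

Let q_ (n : nat) : R := n.+1%:R^-1.

Let q_gt0 n : 0 < q_ n. Proof. by rewrite invr_gt0. Qed.
Let q_le1 n : q_ n <= 1. Proof. by rewrite invf_le1// ler1n. Qed.

Let q_nonincreasing n1 n2 : (n1 <= n2)%N -> q_ n2 <= q_ n1.
Proof. by move=> n12; rewrite lef_pV2 ?posrE// ler_nat. Qed.

Let q_cvg0 : q_ n @[n --> \oo] --> 0.
Proof. exact: cvg_harmonic. Qed.

Let defect_cvg x : D x -> (defect (q_ n) x)%:E @[n --> \oo] --> defect0 x.
Proof.
move=> Dx; rewrite /defect /defect0.
have := f0 Dx; rewrite le_eqVlt => /predU1P[<-|fx0].
  rewrite le0_lneNy//= addey//.
  rewrite (_ : (fun n => _) = fun n => (n%:R : R)%:E); last first.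
    apply/funext => n; rewrite powR0; last by rewrite gt_eqF.
    by rewrite !sub0r mulN1r opprK /q_ invrK -addn1 natrD; congr (_%:E); ring.
  by apply/cvgeryP; exact: cvgr_idn.
rewrite lne_EFin// -EFinB; apply: cvg_EFin; first exact: nearW.
apply: cvgB; first exact: cvg_cst.
apply: (@squeeze_cvgr _ _ _ _ (fun=> ln (f x))
    (fun n => ln (f x) * expR (q_ n * ln (f x)))).
- apply: nearW => n; move: (q_ n) (q_gt0 n) => q qp.
  rewrite /powR gt_eqF// ler_pdivlMr// ler_pdivrMr//.
  have h1 := expR_ge1Dx (q * ln (f x)).
  have h2 := expR_ge1Dx (- (q * ln (f x))).
  have e0 := expR_gt0 (q * ln (f x)).
  have : (1 - q * ln (f x)) * expR (q * ln (f x)) <=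
         expR (- (q * ln (f x))) * expR (q * ln (f x)).
    by rewrite ler_wpM2r// ltW.
  by rewrite -expRD addNr expR0; nra.
- exact: cvg_cst.
- rewrite -[X in _ --> X]mulr1; apply: cvgM; first exact: cvg_cst.
  rewrite -expR0 -(mul0r (ln (f x))).
  apply: continuous_cvg; first exact: continuous_expR.
  by apply: cvgM => //; exact: cvg_cst.
Qed.

Let defect_ge0 n x : D x -> (0 <= (defect (q_ n) x)%:E)%E.
Proof.
move=> Dx; rewrite lee_fin /defect subr_ge0.
apply: le_trans (powR_quot_nondecreasing (f0 Dx) (q_gt0 n) (q_le1 n)) _.
by rewrite invr1 mulr1 powRr1// f0.
Qed.

Let defect_int n : m.-integrable D (EFin \o defect (q_ n)).
Proof.
have q01 : 0 < q_ n <= 1 by rewrite q_gt0 q_le1.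
exact: (integrableB mD (integrableB mD intf (integrable_cst_fin 1)) (integrable_quot q01)).
Qed.

Let defect_meas n : measurable_fun D (fun x => (defect (q_ n) x)%:E).
Proof. exact: measurable_int (defect_int n). Qed.

Let defect0_meas : measurable_fun D defect0.
Proof. exact: emeasurable_fun_cvg defect_meas defect_cvg. Qed.

Let mean_f := \int[m]_(x in D) f x / a.

Let defect_mean n : (\int[m]_(x in D) (defect (q_ n) x)%:E)%E =
  (a * (mean_f - 1 - mean_quot (q_ n)))%:E.
Proof.
rewrite integral_EFin//; congr (_%:E).
have q01 : 0 < q_ n <= 1 by rewrite q_gt0 q_le1.
have fI := integrable_cst_fin 1.
rewrite /defect RintegralB//; [|exact: (integrableB mD intf fI)|exact: integrable_quot].
rewrite RintegralB// Rintegral_cst_fin /mean_f /mean_quot.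
by field; rewrite gt_eqF.
Qed.

Let defect_int_cvg : (a * (mean_f - 1 - mean_quot (q_ n)))%:E @[n --> \oo] -->
  (\int[m]_(x in D) defect0 x)%E.
Proof.
have := cvg_monotone_convergence mD defect_meas defect_ge0.
move=> /(_ m) h.
rewrite (eq_integral (fun x => limn (fun n => (defect (q_ n) x)%:E))).
  rewrite (_ : (fun n => _) = fun n => (\int[m]_(x in D) (defect (q_ n) x)%:E)%E).
    apply: h => x Dx n1 n2 n12; rewrite lee_fin lerD2l lerN2.
    by apply: powR_quot_nondecreasing; rewrite ?f0// q_nonincreasing.
  by apply/funext => n; rewrite defect_mean.
move=> x /set_mem Dx; apply/esym/cvg_lim => //; exact: defect_cvg.
Qed.

Let lneE x : D x -> lne (f x)%:E = ((f x - 1)%:E - defect0 x)%E.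
Proof.
move=> Dx; rewrite /defect0; have := f0 Dx; rewrite le_eqVlt => /predU1P[<-|fx0].
  by rewrite le0_lneNy//= ?addey//= addeNy.
by rewrite lne_EFin// -!EFinB; congr (_%:E); ring.
Qed.

Let lne_meas : measurable_fun D (fun x => lne (f x)%:E).
Proof.
apply: (eq_measurable_fun (fun x => (f x - 1)%:E - defect0 x)%E).
  by move=> x /set_mem Dx; rewrite lneE.
apply: emeasurable_funB => //; apply/measurable_EFinP.
by apply: measurable_funB => //; exact: measurable_cst.
Qed.

Let defect0_ge0 x : D x -> (0 <= defect0 x)%E.
Proof.
move=> Dx; rewrite -(cvg_lim _ (defect_cvg Dx))//; apply: lime_ge.
  by apply/cvg_ex; exists (defect0 x); exact: defect_cvg.
by apply: nearW => n; exact: defect_ge0.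
Qed.

Definition mean_log : \bar R := ((\int[m]_(x in D) lne (f x)%:E) * (a^-1)%:E)%E.

(** When log f is not integrable, f - 1 - log f <= f + (log f)^- shows that the
    negative part of log f is responsible for it; both sides are then -oo. *)
Lemma mean_logE :
  mean_log = ((mean_f - 1)%:E - (\int[m]_(x in D) defect0 x) * (a^-1)%:E)%E.
Proof.
have fI : m.-integrable D (EFin \o (fun x => f x - 1)).
  exact: (integrableB mD intf (integrable_cst_fin 1)).
have mf1 : \int[m]_(x in D) (f x - 1) = a * (mean_f - 1).
  rewrite RintegralB ?Rintegral_cst_fin /mean_f//; last exact: integrable_cst_fin.
  by field; rewrite gt_eqF.
have f1E : (\int[m]_(x in D) (f x - 1)%:E)%E = (a * (mean_f - 1))%:E.
  by rewrite integral_EFin// mf1.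
rewrite /mean_log.
have [dy|dy] := eqVneq (\int[m]_(x in D) defect0 x)%E +oo%E.
  suff -> : (\int[m]_(x in D) lne (f x)%:E)%E = -oo%E.
    by rewrite dy gt0_mulNye ?gt0_mulye ?lte_fin ?invr_gt0.
  have pos_fin : (\int[m]_(x in D) (fun x => lne (f x)%:E)^\+ x < +oo)%E.
    apply: le_lt_trans (integrable_lty mD intf).
    apply: ge0_le_integral => //; first exact: measurable_funepos.
      exact: measurable_int intf.
    move=> x Dx; rewrite funeposE ge_max lee_fin f0// andbT.
    have := f0 Dx; rewrite le_eqVlt => /predU1P[<-|fx0].
      by rewrite le0_lneNy ?leNye.
    by rewrite lne_EFin// lee_fin; have := ln_sublinear fx0; lra.
  have neg_inf : (\int[m]_(x in D) (fun x => lne (f x)%:E)^\- x = +oo)%E.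
    have mneg : measurable_fun D (fun x => lne (f x)%:E)^\-%E by exact: measurable_funeneg.
    have : (\int[m]_(x in D) defect0 x <= \int[m]_(x in D) (f x)%:E +
        \int[m]_(x in D) (fun x => lne (f x)%:E)^\- x)%E.
      rewrite -ge0_integralD//; last exact: measurable_int intf.
      apply: ge0_le_integral => //; first exact: emeasurable_funD (measurable_int _ intf) mneg.
      move=> x Dx; rewrite /defect0 funenegE.
      have := f0 Dx; rewrite le_eqVlt => /predU1P[<-|fx0].
        by rewrite le0_lneNy//= maxye addey.
      rewrite lne_EFin// -EFinB -EFinN -EFin_max -EFinD lee_fin.
      have : - ln (f x) <= Num.max (- ln (f x)) 0 by rewrite le_max lexx.
      lra.
    rewrite dy leye_eq; have [//|ny] :=
      eqVneq (\int[m]_(x in D) (fun x => lne (f x)%:E)^\- x)%E +oo%E.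
    have: (\int[m]_(x in D) (f x)%:E + \int[m]_(x in D) (fun x => lne (f x)%:E)^\- x < +oo)%E.
      apply: lte_add_pinfty; first exact: (integrable_lty mD intf).
      by rewrite ltey.
    by move=> + /eqP e; rewrite e ltxx.
  by rewrite integralE neg_inf addeNy.
have dI : m.-integrable D defect0.
  apply/integrableP; split => //.
  rewrite (eq_integral defect0); last first.
    by move=> x /set_mem Dx; rewrite gee0_abs// defect0_ge0.
  by rewrite ltey.
rewrite (eq_integral (fun x => (f x - 1)%:E - defect0 x)%E); last first.
  by move=> x /set_mem Dx; rewrite lneE.
rewrite (integralB mD fI dI) f1E muleBl//=.
by rewrite -EFinM mulrAC divff ?mul1r// gt_eqF.
Qed.

Lemma mean_log_lty : (mean_log < +oo)%E.
Proof.
rewrite mean_logE; have : (0 <= \int[m]_(x in D) defect0 x)%E by exact: integral_ge0.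
case: (\int[m]_(x in D) defect0 x)%E => [c||//] _; first by rewrite -EFinM -EFinB ltry.
by rewrite gt0_mulye ?lte_fin ?invr_gt0// addeNy.
Qed.

Definition power_mean (q : R) := (\int[m]_(x in D) (f x `^ q) / a) `^ q^-1.

(** From 1 + t <= e^t with t = q mean_quot q. *)
Lemma power_mean_le (q : R) : 0 < q <= 1 -> power_mean q <= expR (mean_quot q).
Proof.
move=> q01; have q0 : 0 < q by case/andP: q01.
have E z : expR z = expR (q * z) `^ q^-1.
  by rewrite /powR gt_eqF ?expR_gt0// expRK mulrA mulVf ?mul1r// gt_eqF.
rewrite /power_mean mean_quotE// [leRHS]E ge0_ler_powR ?nnegrE ?expR_ge0 ?invr_ge0 ?(ltW q0)//.
- rewrite -mean_quotE// divr_ge0// ?(ltW a0)// Rintegral_ge0// => x Dx.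
  exact: powR_ge0.
- exact: expR_ge1Dx.
Qed.

(** Jensen's inequality: with L the mean of log f, the inequality
    f^q >= e^(q L) (1 + q (log f - L)) is integrated. *)
Lemma le_power_mean (q : R) : 0 < q <= 1 -> fine (expeR mean_log) <= power_mean q.
Proof.
move=> q01; have q0 : 0 < q by case/andP: q01.
have : (0 <= \int[m]_(x in D) defect0 x)%E by exact: integral_ge0.
rewrite mean_logE.
case cE : (\int[m]_(x in D) defect0 x)%E => [c||//] _; last first.
  by rewrite gt0_mulye ?lte_fin ?invr_gt0// addeNy/= powR_ge0.
rewrite -EFinM -EFinB/=; set L := mean_f - 1 - c / a.
have dI : m.-integrable D defect0.
  apply/integrableP; split => //.
  rewrite (eq_integral defect0) ?cE ?ltry// => x /set_mem Dx.
  by rewrite gee0_abs// defect0_ge0.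
have iq := integrable_powR q01.
set K := expR (q * L).
have K0 : 0 < K by exact: expR_gt0.
have iL : m.-integrable D (EFin \o (fun x => K * (1 - q * (1 + L) + q * f x))).
  apply: (eq_integrable _ (fun x => (K * (1 - q * (1 + L)))%:E + (K * q)%:E * (f x)%:E)%E) => //.
    by move=> x _; rewrite -EFinM -EFinD/=; congr (_%:E); ring.
  apply: integrableD => //; first exact: integrable_cst_fin.
  exact: integrableZl.
have idK : m.-integrable D (fun x => (K * q)%:E * defect0 x)%E by exact: integrableZl.
have pointwise : {in D, forall x, ((K * (1 - q * (1 + L) + q * f x))%:E <=
    (f x `^ q)%:E + (K * q)%:E * defect0 x)%E}.
  move=> x /set_mem Dx; rewrite /defect0.
  have := f0 Dx; rewrite le_eqVlt => /predU1P[<-|fx0].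
    by rewrite le0_lneNy//= addey// gt0_muley ?lte_fin ?mulr_gt0// addey// leey.
  rewrite lne_EFin// -EFinB -EFinM -EFinD lee_fin.
  have -> : f x `^ q = K * expR (q * (ln (f x) - L)).
    by rewrite /powR gt_eqF// /K -expRD; congr expR; ring.
  have := expR_ge1Dx (q * (ln (f x) - L)).
  by move=> h; rewrite -(ler_pM2l K0) in h; lra.
have := le_integral mD iL (integrableD mD iq idK) pointwise.
rewrite integralD// integral_EFin// integral_EFin// integralZl// cE -EFinM -EFinD lee_fin.
have iqf : m.-integrable D (EFin \o (fun x => q * f x)) by exact: integrableZl_EFin.
have ic := integrable_cst_fin (1 - q * (1 + L)).
rewrite RintegralZl//; last exact: (integrableD mD ic iqf).
rewrite RintegralD// Rintegral_cst_fin RintegralZl//.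
have -> : \int[m]_(x in D) f x = a * mean_f.
  by rewrite /mean_f mulrCA divff ?mulr1// gt_eqF.
have -> : c = a * (mean_f - 1 - L) by rewrite /L; field; rewrite gt_eqF.
have -> : K * ((1 - q * (1 + L)) * a + q * (a * mean_f)) =
   K * a + K * q * (a * (mean_f - 1 - L)) by ring.
rewrite lerD2r -ler_pdivlMr//.
move=> h; rewrite /power_mean.
have -> : expR L = K `^ q^-1.
  by rewrite /K /powR gt_eqF ?expR_gt0// expRK mulrA mulVf ?mul1r// gt_eqF.
rewrite ge0_ler_powR ?nnegrE ?invr_ge0 ?(ltW q0) ?(ltW K0)//.
exact: le_trans (ltW K0) h.
Qed.

(** The power mean lies between exp(mean_log) and exp(mean_quot q); the latter
    is monotone in q, so that its limit along q = 1 / (n + 1) suffices. *)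
Lemma power_mean_cvg : power_mean q @[q --> 0^'+] --> fine (expeR mean_log).
Proof.
have below y : fine (expeR mean_log) < y -> exists n, expR (mean_quot (q_ n)) < y.
  move=> yE; have y0 : 0 < y.
    by apply: le_lt_trans yE; exact/fine_ge0/expeR_ge0.
  suff [n hn] : exists n, mean_quot (q_ n) < ln y.
    by exists n; rewrite -[ltRHS]lnK ?posrE// ltr_expR.
  have : (0 <= \int[m]_(x in D) defect0 x)%E by exact: integral_ge0.
  move: yE defect_int_cvg; rewrite mean_logE.
  have lnE n : (mean_quot (q_ n) < ln y) =
      (a * (mean_f - 1 - ln y) < a * (mean_f - 1 - mean_quot (q_ n))).
    by rewrite ltr_pM2l// ltrD2l ltrN2.
  case: (\int[m]_(x in D) defect0 x)%E => [c||//].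
    rewrite -EFinM -EFinB/= => yE /fine_cvgP[_ h] _.
    have : a * (mean_f - 1 - ln y) < c.
      rewrite mulrC -ltr_pdivlMr// ltrBlDl -ltrBlDr.
      by rewrite -ltr_expR lnK ?posrE.
    move=> /(cvgr_gt _ h)[n _ /(_ n (leqnn n))/=]; rewrite -lnE.
    by exists n.
  move=> _ /cvgeyPgt/(_ (a * (mean_f - 1 - ln y)))[n _ /(_ n (leqnn n))/=].
  by rewrite lte_fin -lnE; exists n.
apply/cvgrPdist_lt => e e0.
have [|n hn] := below (fine (expeR mean_log) + e); first by rewrite ltrDl.
near=> q.
have q0 : 0 < q by [].
have qn : q <= q_ n by near: q; exact: nbhs_right_le.
have q1 : q <= 1 by exact: le_trans (q_le1 n).
have q01 : 0 < q <= 1 by rewrite q0.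
have h1 := le_power_mean q01.
have h2 := power_mean_le q01.
have h3 := mean_quot_nondecreasing q0 qn (q_le1 n).
rewrite -ler_expR in h3.
rewrite distrC ger0_norm ?subr_ge0// ltrBlDl.
exact: le_lt_trans (le_trans h2 h3) hn.
Unshelve. all: by end_near. Qed.

End power_mean.

(** * Lebesgue measure and continuous functions on R^n *)

Section boxes.
Context {R : realType}.

(** The closed ball of the sup norm of centre c and radius r. *)
Definition cbox n (c : 'rV[R]_n) (r : R) : set 'rV[R]_n :=
  [set x | forall i, `|x ord0 i - c ord0 i| <= r].

Lemma rV_cons0 n (x : 'rV[R]_n * measurableTypeR R) : rV_cons x ord0 ord0 = x.2.
Proof.
rewrite /rV_cons (_ : ord0 = lshift n (ord0 : 'I_1)); last exact/val_inj.
by rewrite (@row_mxEl _ 1 1 n) mxE eqxx mulr1n.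
Qed.

Lemma rV_consS n (x : 'rV[R]_n * measurableTypeR R) j :
  rV_cons x ord0 (lift ord0 j) = x.1 ord0 j.
Proof.
rewrite /rV_cons (_ : lift ord0 j = rshift 1 j); last exact/val_inj.
by rewrite (@row_mxEr _ 1 1 n).
Qed.

Lemma measurable_cbox n (c : 'rV[R]_n) r : measurable (cbox c r).
Proof.
rewrite (_ : cbox c r = \bigcap_(i in [set: 'I_n])
   ((fun x : 'rV[R]_n => x ord0 i : measurableTypeR R) @^-1` `[c ord0 i - r, c ord0 i + r])).
  apply: fin_bigcap_measurable => [|i _]; first exact: finite_finset.
  by rewrite -[X in measurable X]setTI; exact: measurable_coord.
apply/seteqP; split => x /= h.
  by move=> i _ /=; rewrite in_itv/= -ler_distl.
by move=> i; have := h i I; rewrite /= in_itv/= -ler_distl.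
Qed.

Lemma cbox_closed n (c : 'rV[R]_n) r : closed (cbox c r).
Proof.
rewrite (_ : cbox c r = \bigcap_(i in [set: 'I_n])
   ((fun x : 'rV[R]_n => x ord0 i) @^-1` `[c ord0 i - r, c ord0 i + r])).
  apply: closed_bigI => i _; apply: closed_comp => [x _|]; last exact: interval_closed.
  exact: coord_continuous.
apply/seteqP; split => x /= h.
  by move=> i _ /=; rewrite in_itv/= -ler_distl.
by move=> i; have := h i I; rewrite /= in_itv/= -ler_distl.
Qed.

Lemma cbox_compact n (c : 'rV[R]_n) r : compact (cbox c r).
Proof.
have := @rV_compact R n (fun i => `[c ord0 i - r, c ord0 i + r]%classic).
move=> /(_ (fun i => @segment_compact _ _ _)).
congr compact; apply/seteqP; split => x /= h i; have := h i; by rewrite /= in_itv/= -ler_distl.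
Qed.

Lemma open_cbox n (U : set 'rV[R]_n) x : open U -> U x ->
  exists2 e, 0 < e & cbox x e `<=` U.
Proof.
rewrite openE => /[apply] /nbhs_ballP[e/= e0 eU].
exists (e / 2); first by rewrite divr_gt0.
move=> y /= hy; apply: eU; split => // i j; rewrite (ord1 i) /ball/= distrC.
by apply: le_lt_trans (hy j) _; rewrite ltr_pdivrMr// ltr_pMr// ltr1n.
Qed.

(** R^n is second countable: cubes with rational centres and radii 1/(k+1). *)
Lemma open_bigcup_cbox n (U : set 'rV[R]_n) : open U ->
  exists (P : set nat) (c : nat -> 'rV[R]_n) (r : nat -> R),
    U = \bigcup_(k in P) cbox (c k) (r k).
Proof.
move=> oU.
pose dec k : 'rV[rat]_n * nat := odflt (0, 0%N) (unpickle k).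
pose c k : 'rV[R]_n := map_mx ratr (dec k).1.
pose r k : R := (dec k).2.+1%:R^-1.
exists [set k | cbox (c k) (r k) `<=` U], c, r.
apply/seteqP; split => [x Ux|x [k /= kU]]; last exact: kU.
have [e e0 eU] := open_cbox oU Ux.
have [k hk] : exists k, k.+1%:R^-1 < e / 2.
  have e20 : 0 < e / 2 by rewrite divr_gt0.
  by have [k _ /(_ k (leqnn k))] := near_infty_natSinv_lt (PosNum e20); exists k.
have near_rat i : exists q : rat, `|x ord0 i - ratr q| <= k.+1%:R^-1.
  have h : x ord0 i - k.+1%:R^-1 < x ord0 i + k.+1%:R^-1.
    by rewrite (@lt_trans _ _ (x ord0 i))// ?ltrBlDr ltrDl invr_gt0.
  have [q] := rat_in_itvoo h; rewrite in_itv/= => /andP[h1 h2].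
  by exists q; rewrite ler_distlC !ltW.
have [q qP] := choice near_rat.
have dE : dec (pickle (\row_i q i : 'rV[rat]_n, k)) = (\row_i q i, k).
  by rewrite /dec pickleK.
exists (pickle (\row_i q i : 'rV[rat]_n, k)) => /=.
  move=> y hy; apply: eU => i; have := hy i; rewrite /c /r dE/= !mxE => hyi.
  rewrite -(subrK (ratr (q i)) (y ord0 i)) -addrA.
  apply: le_trans (ler_normD _ _) _; rewrite (distrC (ratr _)).
  have := qP i; move: (k.+1%:R^-1) hk hyi => t; lra.
by move=> i; rewrite /c /r dE/= !mxE.
Qed.

(** The sigma-algebra is generated by the coordinates, so that cubes are
    measurable. *)
Lemma open_measurable_rV n (U : set 'rV[R]_n) : open U -> measurable U.
Proof.
move=> /open_bigcup_cbox[P [c [r ->]]].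
by apply: bigcup_measurable => k _; exact: measurable_cbox.
Qed.

Lemma continuous_measurable_rV n (f : 'rV[R]_n -> R) :
  continuous f -> measurable_fun setT f.
Proof.
move=> cf; apply: (measurability (RGenOInfty.G (R:=R))).
  exact: RGenOInfty.measurableE.
move=> _ [_ [r ->] <-]; rewrite setTI; apply: open_measurable_rV.
by apply: open_comp => [x _|]; [exact: cf|exact: interval_open].
Qed.

Lemma leb_cbox n (c : 'rV[R]_n) (r : R) : 0 <= r ->
  leb n (cbox c r) = ((r *+ 2) ^+ n)%:E.
Proof.
move=> r0; elim: n c => [|n IHn] c /=.
  by rewrite expr0 diracE mem_set// => -[].
rewrite /pushforward (_ : _ @^-1` _ =
  cbox (\row_j c ord0 (lift ord0 j)) r `*` `[c ord0 ord0 - r, c ord0 ord0 + r]).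
  rewrite product_measure1E//; last exact: measurable_cbox.
  have := lebesgue_measure_itv `[c ord0 ord0 - r, c ord0 ord0 + r].
  rewrite IHn /= lte_fin => ->.
  rewrite exprSr EFinM; congr (_ * _)%E.
  case: ifPn => [_|]; first by rewrite -EFinB; congr (_%:E); ring.
  by rewrite -leNgt => h; congr (_%:E); lra.
apply/seteqP; split => x/=.
  move=> h; split; last by have := h ord0; rewrite rV_cons0 in_itv/= -ler_distl.
  by move=> j; have := h (lift ord0 j); rewrite rV_consS mxE.
move=> [h1 h2] i; case: (@unliftP n.+1 ord0 i) => [j ->|->].
  by have := h1 j; rewrite rV_consS mxE.
by rewrite rV_cons0; rewrite in_itv/= -ler_distl in h2.
Qed.

End boxes.

Section fubini.
Context d1 d2 (T1 : measurableType d1) (T2 : measurableType d2) (R : realType).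
Variables (m1 : {measure set T1 -> \bar R})
  (m2 : {sigma_finite_measure set T2 -> \bar R}) (f : T1 * T2 -> \bar R).
Hypotheses (sf : sigma_finite setT m1) (intf : (m1 \x m2)%E.-integrable setT f).

(** m1 with its sigma-finiteness, which the Fubini theorems expect as part of
    the structure; as a measure it is convertible to m1. *)
Let M : {sigma_finite_measure set T1 -> \bar R} :=
  SigmaFiniteMeasure.Pack (SigmaFiniteMeasure.Class
    (Measure.measure_function_Content_isMeasure_mixin (Measure.class m1))
    (isSFinite.Axioms_ _ _ _ (sfinite_measure_sigma_finite sf))
    (isSigmaFinite.Axioms_ _ _ _ sf)).

Lemma sigma_finite_fubini12 :
  (\int[m1]_x \int[m2]_y f (x, y) = \int[m1 \x m2]_z f z)%E.
Proof. exact: (@integral12_prod_meas1 _ _ _ _ _ M m2 f intf). Qed.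

Lemma sigma_finite_fubini21 :
  (\int[m2]_y \int[m1]_x f (x, y) = \int[m1 \x m2]_z f z)%E.
Proof. exact: (@integral21_prod_meas1 _ _ _ _ _ M m2 f intf). Qed.

End fubini.

Section leb_integral.
Context {R : realType}.

Lemma bounded_cbox n (x : 'rV[R]_n) : exists k : nat, cbox 0 k%:R x.
Proof.
exists (Num.bound (\sum_i `|x ord0 i|)) => i; rewrite mxE subr0.
apply: le_trans (_ : \sum_i `|x ord0 i| <= _).
  by rewrite (bigD1 i)//= lerDl sumr_ge0.
by rewrite ltW// archi_boundP// sumr_ge0.
Qed.

Lemma leb_sigma_finite n : sigma_finite setT (@leb R n).
Proof.
exists (fun k => cbox 0 k%:R).
  by apply/esym/seteqP; split=> // x _; have [k] := bounded_cbox x; exists k.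
move=> k; split; first exact: measurable_cbox.
by rewrite leb_cbox// ltry.
Qed.

Lemma leb_integrable_bounded n (g : 'rV[R]_n -> R) (K M : R) : 0 <= M ->
  measurable_fun setT g -> (forall x, `|g x| <= K) ->
  (forall x, ~ cbox 0 M x -> g x = 0) ->
  (leb n).-integrable setT (EFin \o g).
Proof.
move=> M0 mg gK g0; apply/integrableP; split; first exact/measurable_EFinP.
have mB := @measurable_cbox R n 0 M.
have mag : measurable_fun setT (fun x => `|(EFin \o g) x|)%E.
  by apply: measurableT_comp => //; exact/measurable_EFinP.
rewrite -(setUv (cbox 0 M)) ge0_integral_setU//=; last 3 first.
- exact: measurableC.
- by rewrite setUv.
- exact/disj_setPCl.
rewrite [X in (_ + X)%E]integral0_eq ?adde0; last first.
  by move=> x /g0 ->; rewrite normr0.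
apply: (@le_lt_trans _ _ (\int[leb n]_(x in cbox 0 M) cst K%:E x)%E).
  apply: ge0_le_integral => //.
  - exact: measurable_funTS.
  - by move=> x _; rewrite lee_fin.
by rewrite integral_cst// leb_cbox// -EFinM ltry.
Qed.

Lemma leb_fubini m (g : 'rV[R]_m.+1 -> R) (K M : R) : 0 <= M ->
  measurable_fun setT g -> (forall x, `|g x| <= K) ->
  (forall x, ~ cbox 0 M x -> g x = 0) ->
  (\int[leb m.+1]_x (g x)%:E =
     \int[leb m]_x \int[lebesgue_measure]_t (g (rV_cons (x, t)))%:E /\
   \int[leb m.+1]_x (g x)%:E =
     \int[lebesgue_measure]_t \int[leb m]_x (g (rV_cons (x, t)))%:E)%E.
Proof.
move=> M0 mg gK g0.
have mgE : measurable_fun setT (EFin \o g) by exact/measurable_EFinP.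
have mc : measurable_fun setT (@rV_cons R m) by exact: measurable_rV_cons.
have ig : (leb m \x lebesgue_measure)%E.-integrable setT ((EFin \o g) \o @rV_cons R m).
  have /integrableP[_ h] := leb_integrable_bounded M0 mg gK g0.
  apply/integrableP; split; first exact: measurableT_comp.
  move: h; rewrite /= ge0_integral_pushforward//.
  by apply/measurable_EFinP; exact: measurableT_comp.
have -> : (\int[leb m.+1]_x (g x)%:E =
    \int[leb m \x lebesgue_measure]_z ((EFin \o g) \o @rV_cons R m) z)%E.
  exact: (integral_pushforward mc mgE ig measurableT).
split; first by rewrite -(sigma_finite_fubini12 (leb_sigma_finite m) ig).
by rewrite -(sigma_finite_fubini21 (leb_sigma_finite m) ig).
Qed.

End leb_integral.

Section integral_of_derivative.
Context {R : realType}.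

Lemma continuous_row (T : topologicalType) n (f : T -> 'rV[R]_n) :
  (forall i, continuous (fun x => f x ord0 i)) -> continuous f.
Proof.
move=> cf x; apply/cvg_ballP => e e0.
have : \forall y \near x, forall j, ball (f x ord0 j) e (f y ord0 j).
  by apply: filter_forall => j; move/cvg_ballP : (cf j x); exact.
by apply: filterS => y h; split => // i j; rewrite (ord1 i).
Qed.

Lemma continuous_rV_cons_l n t : continuous (fun x => @rV_cons R n (x, t)).
Proof.
apply: continuous_row => i; case: (unliftP ord0 i) => [j ->|->] x.
  under eq_fun do rewrite rV_consS; exact: coord_continuous.
rewrite (_ : (fun _ => _) = cst (t : R)); first exact: cst_continuous.
by apply/funext => y; rewrite rV_cons0.
Qed.

Lemma continuous_rV_cons_r n x : continuous (fun t : R => @rV_cons R n (x, t)).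
Proof.
apply: continuous_row => i; case: (unliftP ord0 i) => [j ->|->] t.
  rewrite (_ : (fun _ => _) = cst (x ord0 j)); first exact: cst_continuous.
  by apply/funext => s; rewrite rV_consS.
rewrite (_ : (fun _ => _) = id); first exact: cvg_id.
by apply/funext => s; rewrite rV_cons0.
Qed.

Lemma rV_cons_shift0 n h (x : 'rV[R]_n) t :
  h *: delta_mx ord0 ord0 + rV_cons (x, t) = rV_cons (x, h *: (1 : R^o) + t).
Proof.
apply/rowP => i; rewrite [LHS]mxE [X in X + _]mxE [X in _ * X]mxE.
case: (unliftP ord0 i) => [j ->|->].
  by rewrite !rV_consS/= mulr0 add0r.
by rewrite !rV_cons0/= mulr1 /GRing.scale/= mulr1.
Qed.

Lemma rV_cons_shiftS n h j (x : 'rV[R]_n) t :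
  h *: delta_mx ord0 (lift ord0 j) + rV_cons (x, t) =
  rV_cons (h *: delta_mx ord0 j + x, t).
Proof.
apply/rowP => i; rewrite [LHS]mxE [X in X + _]mxE [X in _ * X]mxE.
case: (unliftP ord0 i) => [k ->|->].
  by rewrite !rV_consS/= !mxE (inj_eq lift_inj).
by rewrite !rV_cons0/= mulr0 add0r.
Qed.

Let quot0 n (F : 'rV[R]_n.+1 -> R) x (t : R) :
  (fun h : R => h^-1 *: ((F \o shift (rV_cons (x, t))) (h *: delta_mx ord0 ord0)
                        - F (rV_cons (x, t)))) =
  (fun h : R => h^-1 *: (((fun s : R => F (rV_cons (x, s))) \o shift t) (h *: 1)
                        - F (rV_cons (x, t)))).
Proof. by apply/funext => h /=; rewrite rV_cons_shift0. Qed.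

Let quotS n j (F : 'rV[R]_n.+1 -> R) x (t : R) :
  (fun h : R => h^-1 *:
     ((F \o shift (rV_cons (x, t))) (h *: delta_mx ord0 (lift ord0 j))
       - F (rV_cons (x, t)))) =
  (fun h : R => h^-1 *: (((fun y => F (rV_cons (y, t))) \o shift x) (h *: delta_mx ord0 j)
                        - F (rV_cons (x, t)))).
Proof. by apply/funext => h /=; rewrite rV_cons_shiftS. Qed.

Lemma partial_slice0 n (F : 'rV[R]_n.+1 -> R) x (t : R) :
  partial ord0 F (rV_cons (x, t)) = 'D_1 (fun s : R => F (rV_cons (x, s))) t.
Proof. by rewrite /partial /derive quot0. Qed.

Lemma derivable_slice0 n (F : 'rV[R]_n.+1 -> R) x (t : R) :
  derivable F (rV_cons (x, t)) (delta_mx ord0 ord0) ->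
  derivable (fun s : R => F (rV_cons (x, s))) t 1.
Proof. by rewrite /derivable quot0. Qed.

Lemma partial_sliceS n j (F : 'rV[R]_n.+1 -> R) x (t : R) :
  partial (lift ord0 j) F (rV_cons (x, t)) =
  partial j (fun y => F (rV_cons (y, t))) x.
Proof. by rewrite /partial /derive quotS. Qed.

Lemma derivable_sliceS n j (F : 'rV[R]_n.+1 -> R) x (t : R) :
  derivable F (rV_cons (x, t)) (delta_mx ord0 (lift ord0 j)) ->
  derivable (fun y => F (rV_cons (y, t))) x (delta_mx ord0 j).
Proof. by rewrite /derivable quotS. Qed.

(** F vanishes on a neighbourhood of a point outside the closed set A. *)
Lemma partial_eq0 n i (F : 'rV[R]_n -> R) (A : set 'rV[R]_n) x : closed A ->
  (forall y, ~ A y -> F y = 0) -> ~ A x -> partial i F x = 0.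
Proof.
move=> cA F0 Ax; rewrite /partial (@near_eq_derive _ _ _ F (cst 0)).
  by rewrite derive_cst.
have : open (~` A) by exact: closed_openC.
by rewrite openE => /(_ _ Ax); apply: filterS => y; exact: F0.
Qed.

Lemma continuous_cbox_bounded n (F : 'rV[R]_n -> R) (M : R) : 0 <= M -> continuous F ->
  (forall x, ~ cbox 0 M x -> F x = 0) -> exists K : R, forall x, `|F x| <= K.
Proof.
move=> M0 cF F0.
have [|||c _ cP] := @EVT_max_rV R n (fun x => `|F x|) (cbox 0 M).
- by exists 0 => i; rewrite subrr normr0.
- exact: cbox_compact.
- apply: continuous_subspaceT => x.
  by apply: (@continuous_comp _ _ _ F (fun y : R => `|y|)); [exact: cF|exact: norm_continuous].
exists `|F c| => x; have [xB|xB] := pselect (cbox 0 M x).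
  by apply: cP; rewrite inE.
by rewrite F0// normr0.
Qed.

Lemma integral_derive_compact_support (G : R -> R) (M : R) : 0 <= M ->
  (forall t, derivable G t 1) -> continuous (fun t => 'D_1 G t) ->
  (forall t, M < `|t| -> G t = 0) ->
  (\int[lebesgue_measure]_t ('D_1 G t)%:E = 0)%E.
Proof.
move=> M0 dG cG G0.
have cGG : continuous G.
  by move=> t; apply: differentiable_continuous; apply/derivable1_diffP.
pose b := M + 1.
have Mb : M < b by rewrite ltrDl.
have b0 : 0 < b by exact: le_lt_trans Mb.
have D0 t : M < `|t| -> 'D_1 G t = 0.
  move=> Mt; rewrite (@near_eq_derive _ _ _ G (cst 0)) ?derive_cst//.
  have : `|y| @[y --> t] --> `|t| by apply: cvg_norm; exact: cvg_id.
  by move=> /cvgr_gt/(_ _ Mt); apply: filterS => y; exact: G0.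
have -> : (\int[lebesgue_measure]_t ('D_1 G t)%:E =
    \int[lebesgue_measure]_(t in `[(- b)%R, b]) ('D_1 G t)%:E)%E.
  rewrite [RHS]integral_mkcond; apply: eq_integral => t _; rewrite patchE.
  case: ifPn => //; rewrite notin_setE /= in_itv/= -ler_norml => /negP.
  by rewrite -ltNge => bt; rewrite D0// (lt_trans Mb).
rewrite (@continuous_FTC2 _ _ G).
- by rewrite !G0 ?subee// ?normrN (gtr0_norm b0).
- by rewrite gtrN.
- exact: continuous_subspaceT.
- split; first by move=> t _; exact: dG.
  - exact/cvg_at_right_filter/cGG.
  - exact/cvg_at_left_filter/cGG.
- by move=> t _; rewrite derive1E.
Qed.

(** The integral of a derivative of a compactly supported function vanishes:
    after integrating along the direction of the derivative, this is the
    fundamental theorem of calculus. *)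
Lemma integral_partial_eq0 n (i : 'I_n) (F : 'rV[R]_n -> R) (M : R) : 0 <= M ->
  continuous F -> (forall x, derivable F x (delta_mx ord0 i)) ->
  continuous (partial i F) -> (forall x, ~ cbox 0 M x -> F x = 0) ->
  (\int[leb n]_x (partial i F x)%:E = 0)%E.
Proof.
move=> M0; elim: n i F => [[]//|n IHn] i F cF dF cpF F0.
have D0 x : ~ cbox 0 M x -> partial i F x = 0.
  by apply: partial_eq0 => //; exact: cbox_closed.
have [K DK] := continuous_cbox_bounded M0 cpF D0.
have [fub1 fub2] := leb_fubini M0 (continuous_measurable_rV cpF) DK D0.
case: (unliftP ord0 i) => [j|] iE.
  rewrite fub2; apply: integral0_eq => t _; rewrite iE.
  under eq_integral do rewrite partial_sliceS.
  apply: IHn.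
  - by move=> x; apply: continuous_comp; [exact: continuous_rV_cons_l|exact: cF].
  - by move=> x; apply: derivable_sliceS; rewrite -iE.
  - move=> x; rewrite (_ : partial _ _ = fun x => partial i F (rV_cons (x, t))).
      by apply: continuous_comp; [exact: continuous_rV_cons_l|exact: cpF].
    by apply/funext => y; rewrite iE partial_sliceS.
  - move=> x xB; apply: F0 => h; apply: xB => k; have := h (lift ord0 k).
    by rewrite rV_consS !mxE.
rewrite fub1; apply: integral0_eq => x _; rewrite iE.
under eq_integral do rewrite partial_slice0.
apply: (integral_derive_compact_support M0).
- by move=> t; apply: derivable_slice0; rewrite -iE.
- move=> t; rewrite (_ : (fun _ => _) = fun t => partial i F (rV_cons (x, t))).
    by apply: continuous_comp; [exact: continuous_rV_cons_r|exact: cpF].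
  by apply/funext => y; rewrite iE partial_slice0.
- move=> t Mt; apply: F0 => /(_ ord0); rewrite rV_cons0 mxE subr0/=.
  by rewrite leNgt Mt.
Qed.

End integral_of_derivative.

(** * Smooth functions and the regularized absolute value *)

Section smooth_calculus.
Context {R : realType} {n : nat}.
Implicit Types (f g : 'rV[R]_n -> R) (x v : 'rV[R]_n).

Let quot_line f x v :
  (fun h : R => h^-1 *: (((fun k : R => f (k *: v + x)) \o shift 0) (h *: 1)
     - f (0 *: v + x))) =
  (fun h : R => h^-1 *: ((f \o shift x) (h *: v) - f x)).
Proof.
by apply/funext => h /=; rewrite addr0 scale0r add0r /GRing.scale/= mulr1.
Qed.

(** The chain rule along a line. *)
Lemma derive_comp f (g : R -> R) x v (b : R) :
  derivable f x v -> is_derive (f x) 1 g b ->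
  derivable (g \o f) x v /\ 'D_v (g \o f) x = b * 'D_v f x.
Proof.
move=> df dg.
have dl : derivable (fun k : R => f (k *: v + x)) 0 1 by rewrite /derivable quot_line.
have el : 'D_1 (fun k : R => f (k *: v + x)) 0 = 'D_v f x.
  by rewrite /derive quot_line.
have il : is_derive (0 : R) 1 (fun k : R => f (k *: v + x)) ('D_v f x).
  by apply: DeriveDef.
have dg' : is_derive (f (0 *: v + x)) 1 g b by rewrite scale0r add0r.
have [dc ec] := @is_derive1_comp R g (fun k : R => f (k *: v + x)) 0 b _ dg' il.
by split; [move: dc|move: ec]; rewrite /derivable /derive (quot_line (g \o f)).
Qed.

(** To prove f smooth it suffices to put it in a class of continuous functions
    that is stable under the partial derivatives. *)
Lemma smooth_closed (P : ('rV[R]_n -> R) -> Prop) :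
  (forall f, P f -> [/\ continuous f,
     forall i x, derivable f x (delta_mx ord0 i) & forall i, P (partial i f)]) ->
  forall f, P f -> smooth f.
Proof.
move=> PP f Pf s; have Ps : P (iter_partial s f).
  by elim: s => [//|i s IHs]; have [_ _] := PP _ IHs; exact.
by have [c d _] := PP _ Ps; split => // i x; exact: d.
Qed.

Lemma smooth_continuous f : smooth f -> continuous f.
Proof. by move=> /(_ [::])[]. Qed.

Lemma smooth_derivable f i x : smooth f -> derivable f x (delta_mx ord0 i).
Proof. by move=> /(_ [::])[_]; exact. Qed.

Lemma smooth_partial_continuous f i : smooth f -> continuous (partial i f).
Proof. by move=> /(_ [:: i])[]. Qed.

Lemma smooth_cst (c : R) : smooth (fun _ : 'rV[R]_n => c).
Proof.
apply: (@smooth_closed (fun f => exists c, f = fun=> c)); last by exists c.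
move=> _ [k ->]; split => [|i x|i]; first exact: cst_continuous.
- exact: derivable_cst.
- by exists 0; apply/funext => x; rewrite /partial derive_cst.
Qed.

Lemma partialZ (c : R) f i x : derivable f x (delta_mx ord0 i) ->
  partial i (fun y => c * f y) x = c * partial i f x.
Proof. by move=> df; rewrite /partial; exact: deriveZ. Qed.

Lemma smoothZ (c : R) f : smooth f -> smooth (fun x => c * f x).
Proof.
move=> sf; apply: (@smooth_closed (fun g => exists s, g = fun x => c * iter_partial s f x));
  last by exists [::].
move=> _ [s ->]; have [cs ds] := sf s; split => [|i x|i].
- by move=> x; exact: (cvgM (cvg_cst _) (cs x)).
- by apply: derivableZ; exact: ds.
- exists (i :: s); apply/funext => x; rewrite partialZ//; exact: ds.
Qed.

End smooth_calculus.

Section regularized_abs.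
Context {R : realType} {n : nat}.
Variables (e : R) (f : 'rV[R]_n -> R).
Hypotheses (e0 : 0 < e) (sf : smooth f).

(** A smooth approximation of |f| from below, up to e, with the zeros of f. *)
Definition regabs : 'rV[R]_n -> R := fun x => Num.sqrt (f x ^+ 2 + e ^+ 2) - e.

Let S x : R := Num.sqrt (f x ^+ 2 + e ^+ 2).

Let inside_gt0 x : 0 < f x ^+ 2 + e ^+ 2.
Proof. by rewrite ltr_wpDl ?sqr_ge0// exprn_gt0. Qed.

Let S_gt0 x : 0 < S x. Proof. by rewrite sqrtr_gt0. Qed.

(** dS = f df / S, from S^2 = f^2 + e^2. *)
Let S_derive i x : derivable S x (delta_mx ord0 i) /\
  partial i S x = f x * partial i f x * (S x)^-1.
Proof.
have df : derivable f x (delta_mx ord0 i) by exact: smooth_derivable.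
pose h : 'rV[R]_n -> R := (f * f + cst (e ^+ 2))%R.
have dh : derivable h x (delta_mx ord0 i).
  exact: (derivableD (derivableM df df) (derivable_cst _ _ _)).
have Dh : 'D_(delta_mx ord0 i) h x = 2 * f x * partial i f x.
  rewrite (deriveD (derivableM df df) (derivable_cst _ _ _)) derive_cst addr0.
  by rewrite (deriveM df df) /partial /GRing.scale/=; ring.
have hE : h = fun y => f y ^+ 2 + e ^+ 2 by apply/funext => y; rewrite expr2.
have hx0 : 0 < h x by rewrite hE.
have [d1 d2] := derive_comp dh (is_derive1_sqrt hx0).
have SE : S = Num.sqrt \o h by rewrite hE.
split; first by rewrite SE.
rewrite {1}/partial {1}SE d2 Dh -[Num.sqrt (h x)]/((Num.sqrt \o h) x) -SE.
by move: (S x) (S_gt0 x) => s s0; field; rewrite gt_eqF.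
Qed.

(** The algebra generated by the derivatives of f, by S and by 1 / S is stable
    under differentiation, because dS = f df / S. *)
Inductive regabs_algebra : ('rV[R]_n -> R) -> Prop :=
| ra_iter s : regabs_algebra (iter_partial s f)
| ra_cst c : regabs_algebra (fun=> c)
| ra_S : regabs_algebra S
| ra_SV : regabs_algebra (fun x => (S x)^-1)
| ra_add g h : regabs_algebra g -> regabs_algebra h ->
    regabs_algebra (fun x => g x + h x)
| ra_mul g h : regabs_algebra g -> regabs_algebra h ->
    regabs_algebra (fun x => g x * h x).

Let S_continuous : continuous S.
Proof.
move=> x; apply: (@continuous_comp _ _ _ (fun y => f y ^+ 2 + e ^+ 2) Num.sqrt).
  have cf := smooth_continuous sf (x := x).
  exact: (cvgD (cvgM cf cf) (cvg_cst (e ^+ 2))).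
exact: sqrt_continuous.
Qed.

Lemma regabs_algebra_closed g : regabs_algebra g -> [/\ continuous g,
  forall i x, derivable g x (delta_mx ord0 i) &
  forall i, regabs_algebra (partial i g)].
Proof.
elim => {g} [s|c|||g h _ [cg dg pg] _ [ch dh ph]|g h ag [cg dg pg] ah [ch dh ph]].
- have [cs ds] := sf s; split => // i; exact: (ra_iter (i :: s)).
- have sc := @smooth_cst R n c; split;
  [exact: smooth_continuous|by move=> i x; exact: smooth_derivable|].
  by move=> i; rewrite (_ : partial _ _ = fun=> 0);
    [exact: ra_cst|apply/funext => x; exact: derive_cst].
- split => // [i x|i]; first by have [] := S_derive i x.
  rewrite (_ : partial _ _ = fun x => f x * partial i f x * (S x)^-1).
    apply: ra_mul; last exact: ra_SV.
    by apply: ra_mul; [exact: (ra_iter [::])|exact: (ra_iter [:: i])].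
  by apply/funext => x; have [] := S_derive i x.
- split => [x|i x|i].
  + exact: (cvgV (lt0r_neq0 (S_gt0 x)) (S_continuous (x := x))).
  + exact: (derivableV (lt0r_neq0 (S_gt0 x)) (proj1 (S_derive i x))).
  + rewrite (_ : partial _ _ = fun x => (-1) * ((S x)^-1 * ((S x)^-1 *
       (f x * partial i f x * (S x)^-1)))).
      do 3 (apply: ra_mul; first by [exact: ra_cst|exact: ra_SV]).
      apply: ra_mul; last exact: ra_SV.
      by apply: ra_mul; [exact: (ra_iter [::])|exact: (ra_iter [:: i])].
    apply/funext => x; have [dS pS] := S_derive i x.
    rewrite {1}/partial (deriveV (lt0r_neq0 (S_gt0 x)) dS).
    rewrite -[X in _ *: X]/(partial i S x) pS /GRing.scale/=.
    by move: (S x) (S_gt0 x) => s s0; field; rewrite gt_eqF.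
- split => [x|i x|i].
  + exact: (cvgD (cg x) (ch x)).
  + exact: (derivableD (dg i x) (dh i x)).
  + rewrite (_ : partial _ _ = fun x => partial i g x + partial i h x).
      exact: ra_add.
    by apply/funext => x; exact: (deriveD (dg i x) (dh i x)).
- split => [x|i x|i].
  + exact: (cvgM (cg x) (ch x)).
  + exact: (derivableM (dg i x) (dh i x)).
  + rewrite (_ : partial _ _ = fun x => g x * partial i h x + h x * partial i g x).
      by apply: ra_add; exact: ra_mul.
    by apply/funext => x; exact: (deriveM (dg i x) (dh i x)).
Qed.

Lemma partial_regabs i x :
  partial i regabs x = f x / Num.sqrt (f x ^+ 2 + e ^+ 2) * partial i f x.
Proof.
have [dS pS] := S_derive i x.
have := deriveD dS (derivable_cst (- e) x (delta_mx ord0 i)).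
rewrite derive_cst addr0 => h; rewrite /partial; apply: (etrans h).
by rewrite -[LHS]/(partial i S x) pS mulrAC.
Qed.

End regularized_abs.

Section euclid.
Context {R : realType} {n : nat}.
Implicit Types x y : 'rV[R]_n.

Lemma dotC x y : dot x y = dot y x.
Proof. by apply: eq_bigr => i _; rewrite mulrC. Qed.

Lemma dotDl x y z : dot (x + y) z = dot x z + dot y z.
Proof. by rewrite /dot -big_split; apply: eq_bigr => i _; rewrite mxE mulrDl. Qed.

Lemma dotZl (c : R) x y : dot (c *: x) y = c * dot x y.
Proof. by rewrite /dot mulr_sumr; apply: eq_bigr => i _; rewrite mxE mulrA. Qed.

Lemma dot_ge0 x : 0 <= dot x x.
Proof. by apply: sumr_ge0 => i _; rewrite -expr2 sqr_ge0. Qed.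

Lemma enorm_ge0 x : 0 <= enorm x. Proof. exact: sqrtr_ge0. Qed.

Lemma enorm_sqr x : enorm x ^+ 2 = dot x x.
Proof. by rewrite /enorm sqr_sqrtr// dot_ge0. Qed.

Lemma enormZ (c : R) x : enorm (c *: x) = `|c| * enorm x.
Proof.
by rewrite /enorm dotZl dotC dotZl mulrA -expr2 sqrtrM ?sqr_ge0// sqrtr_sqr.
Qed.

Lemma normr_coord_enorm x i : `|x ord0 i| <= enorm x.
Proof.
rewrite -sqrtr_sqr ler_wsqrtr// /dot (bigD1 i)//= -expr2 lerDl.
by apply: sumr_ge0 => j _; rewrite -expr2 sqr_ge0.
Qed.

(** The Cauchy-Schwarz inequality, from the square of the vector
    |y| x - |x| y. *)
Lemma dot_le_enorm x y : dot x y <= enorm x * enorm y.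
Proof.
have [x0|x0] := eqVneq (enorm x) 0.
  rewrite x0 mul0r /dot big1// => i _.
  have := normr_coord_enorm x i; rewrite x0 normr_le0 => /eqP ->.
  by rewrite mul0r.
have [y0|y0] := eqVneq (enorm y) 0.
  rewrite y0 mulr0 /dot big1// => i _.
  have := normr_coord_enorm y i; rewrite y0 normr_le0 => /eqP ->.
  by rewrite mulr0.
have xp : 0 < enorm x by rewrite lt_neqAle eq_sym x0 enorm_ge0.
have yp : 0 < enorm y by rewrite lt_neqAle eq_sym y0 enorm_ge0.
have := dot_ge0 (enorm y *: x + (- enorm x) *: y).
rewrite dotDl !dotZl ![dot _ (_ + _)]dotC !dotDl !dotZl (dotC y x) -!enorm_sqr => h.
have xy := mulr_gt0 xp yp.
by rewrite -(ler_pM2l xy); move: (enorm x) (enorm y) (dot x y) h => s t u; nra.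
Qed.

Lemma enormD x y : enorm (x + y) <= enorm x + enorm y.
Proof.
rewrite -(@ler_pXn2r _ 2)// ?nnegrE ?addr_ge0 ?enorm_ge0//.
rewrite enorm_sqr dotDl ![dot _ (_ + _)]dotC !dotDl (dotC y x) -!enorm_sqr.
by have := dot_le_enorm x y; lra.
Qed.

Lemma normr_coord_le x i : `|x ord0 i| <= `|x|.
Proof.
have -> : `|x| = mx_norm x by [].
rewrite mx_normrE.
exact: (le_bigmax _ (fun ij : 'I_1 * 'I_n => `|x ij.1 ij.2|) (ord0, i)).
Qed.

End euclid.

Section regabs_test.
Context {R : realType} {n : nat}.
Variables (e : R) (f : 'rV[R]_n -> R).
Hypotheses (e0 : 0 < e).

Let inside_gt0 x : 0 < f x ^+ 2 + e ^+ 2.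
Proof. by rewrite ltr_wpDl ?sqr_ge0// exprn_gt0. Qed.

Lemma regabs_eq0 x : f x = 0 -> regabs e f x = 0.
Proof.
move=> f0; rewrite /regabs f0 expr0n add0r sqrtr_sqr.
by rewrite (gtr0_norm e0) subrr.
Qed.

Lemma regabs_ge0 x : 0 <= regabs e f x.
Proof.
rewrite /regabs subr_ge0 -{1}(gtr0_norm e0) -(sqrtr_sqr e).
by rewrite ler_wsqrtr// lerDr sqr_ge0.
Qed.

Lemma normr_le_regabs x : `|f x| <= regabs e f x + e.
Proof.
by rewrite /regabs subrK -sqrtr_sqr ler_wsqrtr// lerDl sqr_ge0.
Qed.

Hypothesis sf : smooth f.

Let regabs_algebraE : regabs_algebra e f (regabs e f).
Proof. exact: (ra_add (ra_S e f) (ra_cst e f (- e))). Qed.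

Lemma smooth_regabs : smooth (regabs e f).
Proof. exact: (smooth_closed (regabs_algebra_closed e0 sf)). Qed.

(** grad (regabs e f) = (f / sqrt(f^2 + e^2)) grad f. *)
Lemma enorm_grad_regabs x : enorm (grad (regabs e f) x) <= enorm (grad f x).
Proof.
have s0 : 0 < Num.sqrt (f x ^+ 2 + e ^+ 2) by rewrite sqrtr_gt0.
rewrite (_ : grad (regabs e f) x =
    (f x / Num.sqrt (f x ^+ 2 + e ^+ 2)) *: grad f x).
  rewrite enormZ ler_piMl ?enorm_ge0// normrM normfV (gtr0_norm s0).
  by rewrite ler_pdivrMr// mul1r -sqrtr_sqr ler_wsqrtr// lerDl sqr_ge0.
by apply/rowP => i; rewrite !mxE partial_regabs.
Qed.

Lemma test_function_regabs Omega : test_function Omega f ->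
  test_function Omega (regabs e f).
Proof.
move=> [_ cf fO]; have sub : [set x | regabs e f x != 0] `<=` [set x | f x != 0].
  by move=> x /=; apply: contra => /eqP/regabs_eq0 ->.
split; [exact: smooth_regabs| |exact: subset_trans (closure_subset sub) fO].
apply: subclosed_compact cf _; [exact: closed_closure|exact: closure_subset].
Qed.

End regabs_test.

(** * p-th powers of the Lebesgue norms *)

Section Lp.
Context {R : realType} {n : nat}.
Variables (p : R) (Omega : set 'rV[R]_n).
Hypotheses (p1 : 1 < p) (mO : measurable Omega).
Implicit Types v w : 'rV[R]_n -> R.

Let p0 : 0 < p. Proof. exact: lt_trans p1. Qed.

Definition int_pow v : \bar R := (\int[leb n]_(x in Omega) (`|v x| `^ p)%:E)%E.

Lemma int_pow_ge0 v : (0 <= int_pow v)%E.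
Proof. by apply: integral_ge0 => x _; rewrite lee_fin powR_ge0. Qed.

Lemma measurable_powR_norm v q : measurable_fun Omega v ->
  measurable_fun Omega (fun x => (`|v x| `^ q)%:E).
Proof.
move=> mv; apply/measurable_EFinP/measurable_fun_powR.
exact: measurableT_comp.
Qed.

Lemma Lp_norm_powR v : ((Lp_norm p Omega v) `^ p = int_pow v)%E.
Proof.
rewrite /Lp_norm (powR_Lnorm _ _ (lt0r_neq0 p0)) /int_pow [RHS]integral_mkcond.
apply: eq_integral => x _; rewrite /= !patchE; case: ifPn => // _.
by rewrite normr0 powR0 ?gt_eqF.
Qed.

Lemma Lp_norm_ge0 v : (0 <= Lp_norm p Omega v)%E.
Proof. exact: Lnorm_ge0. Qed.

Lemma Lp_normE v : Lp_norm p Omega v = ((int_pow v) `^ p^-1)%E.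
Proof.
by rewrite -Lp_norm_powR -poweRrM divff ?gt_eqF// poweRe1// Lp_norm_ge0.
Qed.

(** The Lebesgue spaces of the definitions concern the extension by 0 of v to
    the whole space; here they are read on Omega. *)
Lemma in_LpP v : in_Lp p Omega v <-> measurable_fun Omega v /\ (int_pow v < +oo)%E.
Proof.
have E : ((Lp_norm p Omega v < +oo) = (int_pow v < +oo))%E.
  apply/idP/idP => h; last by rewrite Lp_normE poweR_lty.
  by rewrite -Lp_norm_powR poweR_lty.
have mE : measurable_fun Omega v <-> measurable_fun setT (v \_ Omega).
  exact: measurable_restrictT.
rewrite /in_Lp /Lfun inE; split.
  move=> /andP[/set_mem h1 /set_mem h2]; split; first by apply/mE.
  by rewrite -E.
move=> [/mE h1 h2]; apply/andP; split; apply/mem_set => //.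
by move: h2; rewrite -E.
Qed.

Lemma int_powZ (c : R) v : measurable_fun Omega v ->
  int_pow (fun x => c * v x) = ((`|c| `^ p)%:E * int_pow v)%E.
Proof.
move=> mv; rewrite /int_pow -ge0_integralZl//.
- by apply: eq_integral => x _; rewrite normrM powRM// EFinM.
- exact: measurable_powR_norm.
Qed.

Lemma Lp_normZ (c : R) v : measurable_fun Omega v ->
  Lp_norm p Omega (fun x => c * v x) = (`|c|%:E * Lp_norm p Omega v)%E.
Proof.
move=> mv; rewrite !Lp_normE int_powZ// poweRM ?lee_fin ?powR_ge0 ?int_pow_ge0//.
by rewrite poweR_EFin -powRrM divff ?gt_eqF// powRr1.
Qed.

Lemma le_int_pow v w : measurable_fun Omega v -> measurable_fun Omega w ->
  (forall x, Omega x -> `|v x| <= `|w x|) -> (int_pow v <= int_pow w)%E.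
Proof.
move=> mv mw vw; apply: (ge0_le_integral _ mO).
- by move=> x _; rewrite lee_fin powR_ge0.
- exact: measurable_powR_norm.
- exact: measurable_powR_norm.
- move=> x Ox; rewrite lee_fin; apply: ge0_ler_powR; first exact: ltW.
  + by rewrite nnegrE.
  + by rewrite nnegrE.
  + exact: vw.
Qed.

Lemma le_Lp_norm v w : measurable_fun Omega v -> measurable_fun Omega w ->
  (forall x, Omega x -> `|v x| <= `|w x|) ->
  (Lp_norm p Omega v <= Lp_norm p Omega w)%E.
Proof.
move=> mv mw vw; rewrite !Lp_normE.
have pV0 : 0 <= p^-1 by rewrite invr_ge0 ltW.
apply: (gt0_ler_poweR pV0);
  [by rewrite in_itv/= int_pow_ge0 leey|by rewrite in_itv/= int_pow_ge0 leey|].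
exact: le_int_pow.
Qed.

Lemma Lp_normD v w : measurable_fun Omega v -> measurable_fun Omega w ->
  (Lp_norm p Omega (fun x => v x + w x)%R <= Lp_norm p Omega v + Lp_norm p Omega w)%E.
Proof.
move=> mv mw; have mv' : measurable_fun setT (v \_ Omega)
  by move: mv; apply: (measurable_restrictT _ mO).1.
have mw' : measurable_fun setT (w \_ Omega) by move: mw; apply: (measurable_restrictT _ mO).1.
have := minkowski_EFin (leb n) mv' mw' (ltW p1); apply: le_trans.
rewrite /Lp_norm le_eqVlt; apply/orP; left; apply/eqP; congr Lnorm.
apply/funext => x; rewrite /= !patchE.
by case: ifPn => // _; rewrite addr0.
Qed.

Lemma Lp_norm0 : Lp_norm p Omega (fun=> 0) = 0%E.
Proof.
rewrite Lp_normE /int_pow integral0_eq ?poweR0r// ?invr_eq0 ?gt_eqF// => x _.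
by rewrite normr0 powR0// gt_eqF.
Qed.

End Lp.

Section domain.
Context {R : realType} {n : nat} (Omega : set 'rV[R]_n).

Lemma bounded_set_cbox : bounded_set Omega ->
  exists2 M : R, 0 <= M & Omega `<=` cbox 0 M.
Proof.
move=> [M [Mr MO]]; exists (`|M| + 1); first by rewrite addr_ge0.
move=> x Ox i; rewrite mxE subr0; apply: le_trans (normr_coord_le x i) _.
by apply: MO => //; rewrite (le_lt_trans (ler_norm M))// ltrDl.
Qed.

Lemma leb_bounded_lty : measurable Omega -> bounded_set Omega ->
  (leb n Omega < +oo)%E.
Proof.
move=> mO /bounded_set_cbox[M M0 OM].
apply: (@le_lt_trans _ _ (leb n (cbox 0 M))); last by rewrite leb_cbox// ltry.
by apply: le_measure; rewrite ?inE//; exact: measurable_cbox.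
Qed.

Lemma leb_fineK : measurable Omega -> bounded_set Omega ->
  leb n Omega = (fine (leb n Omega))%:E.
Proof. by move=> mO bO; rewrite fineK// ge0_fin_numE// leb_bounded_lty. Qed.

Lemma leb_open_gt0 : open Omega -> Omega !=set0 -> (0 < leb n Omega)%E.
Proof.
move=> oO [x Ox]; have [e e0 eO] := open_cbox oO Ox.
apply: (@lt_le_trans _ _ (leb n (cbox x e))).
  by rewrite leb_cbox ?(ltW e0)// lte_fin exprn_gt0// pmulrn_lgt0.
apply: le_measure; rewrite ?inE//; first exact: measurable_cbox.
exact: open_measurable_rV.
Qed.

End domain.

(** * Test functions and the Sobolev space W_0^{1,p} *)

Section test_functions.
Context {R : realType} {n : nat}.
Variables (p : R) (Omega : set 'rV[R]_n).
Hypotheses (p1 : 1 < p) (oO : open Omega) (bO : bounded_set Omega).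
Implicit Types (f psi v : 'rV[R]_n -> R) (i : 'I_n).

Let mO : measurable Omega. Proof. exact: open_measurable_rV. Qed.

Let Ofin : (leb n Omega < +oo)%E. Proof. exact: leb_bounded_lty. Qed.

Lemma test_function_cbox f : test_function Omega f ->
  exists2 M : R, 0 <= M & forall x, ~ cbox 0 M x -> f x = 0.
Proof.
move=> [_ /compact_bounded/bounded_set_cbox[M M0 fM] _]; exists M => // x xM.
have [//|fx] := eqVneq (f x) 0.
by exfalso; apply/xM/fM; exact: subset_closure.
Qed.

Lemma test_function_eq0 f x : test_function Omega f -> ~ Omega x -> f x = 0.
Proof.
move=> [_ _ fO] Ox; have [//|fx] := eqVneq (f x) 0.
by exfalso; apply/Ox/fO/subset_closure.
Qed.

Lemma test_function_partial_eq0 f i x : test_function Omega f -> ~ Omega x ->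
  partial i f x = 0.
Proof.
move=> [_ _ fO] Ox.
apply: (@partial_eq0 _ _ _ _ (closure [set x | f x != 0])).
- exact: closed_closure.
- by move=> y fy; apply/eqP/negPn/negP => fy0; apply/fy/subset_closure.
- by move=> /fO.
Qed.

Lemma integral_test_functionM (h psi : 'rV[R]_n -> R) :
  (forall x, ~ Omega x -> psi x = 0) ->
  (\int[leb n]_(x in Omega) (h x * psi x)%:E = \int[leb n]_x (h x * psi x)%:E)%E.
Proof.
move=> psi0; rewrite integral_mkcond; apply: eq_integral => x _; rewrite patchE.
by case: ifPn => //; rewrite notin_setE => /psi0 ->; rewrite mulr0.
Qed.

Lemma continuous_compact_support_integrable (h : 'rV[R]_n -> R) (M : R) :
  0 <= M -> continuous h -> (forall x, ~ cbox 0 M x -> h x = 0) ->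
  (leb n).-integrable setT (EFin \o h).
Proof.
move=> M0 ch h0; have [K hK] := continuous_cbox_bounded M0 ch h0.
exact: (leb_integrable_bounded M0 (continuous_measurable_rV ch) hK h0).
Qed.

(** From integral_partial_eq0 for f psi, whose support lies in that of psi.
    It is used for f a test function and for f a coordinate of R^n. *)
Lemma integration_by_parts_test f psi i : continuous f ->
  (forall x, derivable f x (delta_mx ord0 i)) -> continuous (partial i f) ->
  test_function Omega psi ->
  (\int[leb n]_(x in Omega) (f x * partial i psi x)%:E =
   - \int[leb n]_(x in Omega) (partial i f x * psi x)%:E)%E.
Proof.
move=> cf df cpf tpsi; have [spsi _ _] := tpsi.
have [M M0 psiM] := test_function_cbox tpsi.
have cpsi := smooth_continuous spsi.
have dpsi x : derivable psi x (delta_mx ord0 i) by exact: smooth_derivable.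
have cppsi := smooth_partial_continuous (i := i) spsi.
have ppsiM x : ~ cbox 0 M x -> partial i psi x = 0.
  by apply: partial_eq0 => //; exact: cbox_closed.
rewrite !integral_test_functionM; last 2 first.
- by move=> x; exact: test_function_eq0.
- by move=> x; exact: test_function_partial_eq0.
have int1 : (leb n).-integrable setT (EFin \o (fun x => f x * partial i psi x)).
  apply: (continuous_compact_support_integrable M0).
    by move=> x; exact: (cvgM (cf x) (cppsi x)).
  by move=> x /ppsiM ->; rewrite mulr0.
have int2 : (leb n).-integrable setT (EFin \o (fun x => partial i f x * psi x)).
  apply: (continuous_compact_support_integrable M0).
    by move=> x; exact: (cvgM (cpf x) (cpsi x)).
  by move=> x /psiM ->; rewrite mulr0.
have pE : partial i (f * psi)%R = fun x => f x * partial i psi x + partial i f x * psi x.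
  by apply/funext => x; rewrite /partial (deriveM (df x) (dpsi x)) (mulrC ('D__ f x)).
have sum0 : (\int[leb n]_x (partial i (f * psi)%R x)%:E = 0)%E.
  apply: (@integral_partial_eq0 R n i (f * psi)%R M M0).
  - by move=> x; exact: (cvgM (cf x) (cpsi x)).
  - by move=> x; exact: (derivableM (df x) (dpsi x)).
  - rewrite pE => x.
    exact: (cvgD (cvgM (cf x) (cppsi x)) (cvgM (cpf x) (cpsi x))).
  - by move=> x xM; rewrite -[LHS]/(f x * psi x) psiM// mulr0.
move: sum0; rewrite pE (integralD measurableT int1 int2).
rewrite (integral_EFin measurableT int1) (integral_EFin measurableT int2).
rewrite -EFinD => -[] sum0; rewrite -EFinN; congr (_%:E).
by apply/eqP; rewrite -subr_eq0 opprK; apply/eqP.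
Qed.

Lemma in_Lp_bounded v (K : R) : measurable_fun Omega v ->
  (forall x, Omega x -> `|v x| <= K) -> in_Lp p Omega v.
Proof.
move=> mv vK; apply/(in_LpP p1 mO); split => //.
apply: (@le_lt_trans _ _ (\int[leb n]_(x in Omega) cst (K `^ p)%:E x)%E).
  apply: ge0_le_integral => //.
  - exact: measurable_powR_norm.
  - move=> x Ox; rewrite lee_fin ge0_ler_powR ?nnegrE ?vK//.
      by rewrite ltW// (lt_trans _ p1).
    exact: le_trans (vK x Ox).
rewrite (integral_cst _ mO); apply: lte_mul_pinfty => //.
by rewrite lee_fin powR_ge0.
Qed.

Lemma test_function_W01p f : test_function Omega f -> W01p p Omega f (grad f).
Proof.
move=> tf; have [sf _ _] := tf.
have cp_in_Lp (h : 'rV[R]_n -> R) : continuous h ->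
    (exists2 M : R, 0 <= M & forall x, ~ cbox 0 M x -> h x = 0) -> in_Lp p Omega h.
  move=> ch [M M0 hM]; have [K hK] := continuous_cbox_bounded M0 ch hM.
  apply: (@in_Lp_bounded _ K) => [|x _]; last exact: hK.
  exact: measurable_funTS (continuous_measurable_rV ch).
have [M M0 fM] := test_function_cbox tf.
split; last first.
  exists (fun=> f); split => //.
  - rewrite (_ : (fun=> _) = fun=> 0%E); first exact: cvg_cst.
    apply/funext => _; rewrite -[RHS](Lp_norm0 Omega p1); congr Lp_norm.
    by apply/funext => x; rewrite subrr.
  - rewrite (_ : (fun=> _) = fun=> 0%E); first exact: cvg_cst.
    apply/funext => _; rewrite -[RHS](Lp_norm0 Omega p1); congr Lp_norm.
    by apply/funext => x; rewrite subrr /enorm /dot big1 ?sqrtr0// => i _; rewrite mxE mul0r.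
split.
- by apply: cp_in_Lp; [exact: smooth_continuous|exists M].
- move=> i; rewrite (_ : (fun _ => _) = partial i f); last first.
    by apply/funext => x; rewrite mxE.
  apply: cp_in_Lp; first exact: smooth_partial_continuous.
  by exists M => // x; by apply: partial_eq0 => //; exact: cbox_closed.
- move=> i psi tpsi; rewrite integration_by_parts_test//.
  + by congr (- _)%E; apply: eq_integral => x _; rewrite mxE.
  + exact: smooth_continuous.
  + by move=> x; exact: smooth_derivable.
  + exact: smooth_partial_continuous.
Qed.

End test_functions.

Section W01p_theory.
Context {R : realType} {n : nat}.
Variables (p : R) (Omega : set 'rV[R]_n).
Hypotheses (p1 : 1 < p) (oO : open Omega) (bO : bounded_set Omega).
Implicit Types (f psi v w : 'rV[R]_n -> R) (g : 'rV[R]_n -> 'rV[R]_n) (i : 'I_n).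

Let mO : measurable Omega. Proof. exact: open_measurable_rV. Qed.
Let p0 : 0 < p. Proof. exact: lt_trans p1. Qed.

Let a := fine (leb n Omega).

Let aE : leb n Omega = a%:E.
Proof. exact: leb_fineK. Qed.

(** On a set of finite measure, from |v| <= 1 + |v|^p. *)
Lemma in_Lp_integrable v : in_Lp p Omega v -> (leb n).-integrable Omega (EFin \o v).
Proof.
move=> /(in_LpP p1 mO)[mv ev].
have ipow : (leb n).-integrable Omega (fun x => (`|v x| `^ p)%:E).
  apply/integrableP; split; first exact: measurable_powR_norm.
  by under eq_integral do rewrite gee0_abs ?lee_fin ?powR_ge0//.
apply: (le_integrable mO _ _ (integrableD mO (integrable_cst_fin mO aE 1) ipow)).
  exact/measurable_EFinP.
move=> x _ /=; rewrite lee_fin [leRHS]ger0_norm ?addr_ge0 ?powR_ge0//.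
have := @powR_le_split _ `|v x| 1 p 1 (normr_ge0 _) ltr01 ltr01 (ltW p1).
by rewrite !powR1 powRr1// mul1r.
Qed.

Lemma integrable_bounded_mul v psi (K : R) :
  (leb n).-integrable Omega (EFin \o v) -> measurable_fun Omega psi ->
  (forall x, `|psi x| <= K) ->
  (leb n).-integrable Omega (EFin \o (fun x => v x * psi x)).
Proof.
move=> iv mpsi psiK.
have K0 : 0 <= K by exact: le_trans (psiK 0).
apply: (le_integrable mO _ _ (integrableZl_EFin K mO iv)).
  apply/measurable_EFinP/measurable_funM => //.
  by apply/measurable_EFinP; exact: measurable_int iv.
move=> x _ /=; rewrite lee_fin !normrM mulrC (ger0_norm K0).
by rewrite ler_wpM2r.
Qed.

Lemma measurable_enorm g : (forall i, measurable_fun Omega (fun x => g x ord0 i)) ->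
  measurable_fun Omega (fun x => enorm (g x)).
Proof.
move=> mg.
have md : measurable_fun Omega (fun x => dot (g x) (g x)).
  by apply: measurable_sum => i; exact: measurable_funM.
have ms : measurable_fun setT (@Num.sqrt R).
  by apply: continuous_measurable_fun; exact: sqrt_continuous.
exact: (@measurableT_comp _ _ _ _ _ _ _ _ _ ms md).
Qed.

Lemma W01p_measurable v g : W01p p Omega v g -> measurable_fun Omega v.
Proof. by move=> [[/(in_LpP p1 mO)[]]]. Qed.

Lemma W01p_measurable_grad v g i : W01p p Omega v g ->
  measurable_fun Omega (fun x => g x ord0 i).
Proof. by move=> [[_ /(_ i)/(in_LpP p1 mO)[]]]. Qed.

Lemma test_function_measurable f : test_function Omega f -> measurable_fun Omega f.
Proof.
move=> [sf _ _].
exact: measurable_funTS (continuous_measurable_rV (smooth_continuous sf)).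
Qed.

Lemma test_function_measurable_partial f i : test_function Omega f ->
  measurable_fun Omega (partial i f).
Proof.
move=> [sf _ _]; apply: measurable_funTS (continuous_measurable_rV _).
exact: smooth_partial_continuous.
Qed.

Lemma measurable_grad_sub f v g : test_function Omega f -> W01p p Omega v g ->
  measurable_fun Omega (fun x => enorm (grad f x - g x)).
Proof.
move=> tf Wv; apply: measurable_enorm => i.
rewrite (_ : (fun _ => _) = fun x => partial i f x - g x ord0 i).
  apply: measurable_funB; first exact: test_function_measurable_partial.
  exact: W01p_measurable_grad Wv.
by apply/funext => x; rewrite !mxE.
Qed.

Lemma measurable_enorm_grad f : test_function Omega f ->
  measurable_fun Omega (fun x => enorm (grad f x)).
Proof.
move=> tf; apply: measurable_enorm => i.
rewrite (_ : (fun _ => _) = partial i f).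
  exact: test_function_measurable_partial.
by apply/funext => x; rewrite !mxE.
Qed.

Lemma test_function_bounded f : test_function Omega f ->
  exists K : R, forall x, `|f x| <= K.
Proof.
move=> tf; have [sf _ _] := tf; have [M M0 fM] := test_function_cbox tf.
exact: (continuous_cbox_bounded M0 (smooth_continuous sf) fM).
Qed.

Lemma test_function_partial_bounded f i : test_function Omega f ->
  exists K : R, forall x, `|partial i f x| <= K.
Proof.
move=> tf; have [sf _ _] := tf; have [M M0 fM] := test_function_cbox tf.
apply: (continuous_cbox_bounded M0); first exact: smooth_partial_continuous.
by move=> x; apply: partial_eq0 => //; exact: cbox_closed.
Qed.

Lemma test_functionZ (c : R) f : test_function Omega f ->
  test_function Omega (fun x => c * f x).
Proof.
move=> [sf cf fO]; have sub : [set x | c * f x != 0] `<=` [set x | f x != 0].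
  by move=> x /=; apply: contra => /eqP ->; rewrite mulr0.
split; [exact: smoothZ| |exact: subset_trans (closure_subset sub) fO].
by apply: subclosed_compact cf _; [exact: closed_closure|exact: closure_subset].
Qed.

Lemma W01pZ (c : R) v g : W01p p Omega v g ->
  W01p p Omega (fun x => c * v x) (fun x => c *: g x).
Proof.
move=> Wv; have mv := W01p_measurable Wv.
have [[Lv Lg wg] [phi [tphi phiv phig]]] := Wv.
have LZ h : in_Lp p Omega h -> in_Lp p Omega (fun x => c * h x).
  move=> /(in_LpP p1 mO)[mh eh]; apply/(in_LpP p1 mO); split.
    by apply: measurable_funM => //; exact: measurable_cst.
  by rewrite int_powZ//; apply: lte_mul_pinfty => //; rewrite lee_fin powR_ge0.
split; first split.
- exact: LZ.
- move=> i; rewrite (_ : (fun _ => _) = fun x => c * g x ord0 i); first exact: LZ.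
  by apply/funext => x; rewrite mxE.
- move=> i psi tpsi.
  have [K psiK] := test_function_bounded tpsi.
  have [L dpsiL] := test_function_partial_bounded i tpsi.
  have i1 := integrable_bounded_mul (in_Lp_integrable Lv)
    (test_function_measurable_partial i tpsi) dpsiL.
  have i2 := integrable_bounded_mul (in_Lp_integrable (Lg i)) (test_function_measurable tpsi) psiK.
  have := wg i psi tpsi; rewrite (integral_EFin mO i1) (integral_EFin mO i2) -EFinN => -[] e.
  under eq_integral do rewrite -mulrA.
  under [in RHS]eq_integral do rewrite mxE -mulrA.
  rewrite (integral_EFin mO (integrableZl_EFin c mO i1)).
  rewrite (integral_EFin mO (integrableZl_EFin c mO i2)).
  by rewrite !RintegralZl// e -EFinN mulrN.
exists (fun k x => c * phi k x); split.
- by move=> k; exact: test_functionZ.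
- rewrite (_ : (fun _ => _) = fun k => (`|c|%:E * Lp_norm p Omega (fun x => (phi k x - v x)%R))%E).
    by rewrite -(mule0 `|c|%:E); apply: cvgeZl.
  apply/funext => k; rewrite -Lp_normZ//.
    by congr Lp_norm; apply/funext => x; rewrite mulrBr.
  by apply: measurable_funB => //; exact: test_function_measurable.
- rewrite (_ : (fun _ => _) = fun k => (`|c|%:E * Lp_norm p Omega (fun x =>
  enorm (grad (phi k) x - g x)))%E).
    by rewrite -(mule0 `|c|%:E); apply: cvgeZl.
  apply/funext => k; rewrite -(normr_id c) -Lp_normZ//; last exact: measurable_grad_sub Wv.
  congr Lp_norm; apply/funext => x; rewrite -enormZ scalerBr; congr enorm; congr (_ - _).
  apply/rowP => i; rewrite !mxE partialZ//; apply: smooth_derivable.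
  by have [] := tphi k.
Qed.

End W01p_theory.

Section approximation.
Context {R : realType} {n : nat}.
Variables (p : R) (Omega : set 'rV[R]_n).
Hypotheses (p1 : 1 < p) (oO : open Omega) (bO : bounded_set Omega).
Implicit Types (f psi v w : 'rV[R]_n -> R) (g : 'rV[R]_n -> 'rV[R]_n) (i : 'I_n).

Let mO : measurable Omega. Proof. exact: open_measurable_rV. Qed.
Let p0 : 0 < p. Proof. exact: lt_trans p1. Qed.

Let a := fine (leb n Omega).

Let aE : leb n Omega = a%:E.
Proof. exact: leb_fineK. Qed.

Let a0 : 0 <= a. Proof. exact: fine_ge0. Qed.

Lemma int_pow_cvg0 (h : nat -> 'rV[R]_n -> R) :
  Lp_norm p Omega (h k) @[k --> \oo] --> 0%E ->
  forall delta : R, 0 < delta -> \forall k \near \oo, (int_pow p Omega (h k) <= delta%:E)%E.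
Proof.
move=> /fine_cvgP[hfin hcvg] delta d0.
have r0 : 0 < delta `^ p^-1 by exact: powR_gt0.
near=> k.
have fk : Lp_norm p Omega (h k) \is a fin_num by near: k.
have lk : fine (Lp_norm p Omega (h k)) < delta `^ p^-1.
  by near: k; exact: (cvgr_lt _ hcvg).
rewrite -(Lp_norm_powR Omega p1) -(fineK fk) poweR_EFin lee_fin.
have -> : delta = (delta `^ p^-1) `^ p.
  by rewrite -powRrM mulVf ?gt_eqF// powRr1// ltW.
apply: ge0_ler_powR; rewrite ?nnegrE ?(ltW p0) ?powR_ge0 ?(ltW lk)//.
exact/fine_ge0/Lp_norm_ge0.
Unshelve. all: by end_near. Qed.

Lemma int_powR_le_split (q eta : R) v : 0 < q -> q <= p -> 0 < eta ->
  measurable_fun Omega v ->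
  (\int[leb n]_(x in Omega) (`|v x| `^ q)%:E <=
    (eta `^ q * a)%:E + (eta `^ (q - p))%:E * int_pow p Omega v)%E.
Proof.
move=> q0 qp eta0 mv.
have m1 := measurable_powR_norm p mv.
rewrite EFinM -aE -(integral_cst (leb n) mO) /int_pow -ge0_integralZl//; last first.
  by rewrite lee_fin powR_ge0.
have m2 : measurable_fun Omega (fun x => (eta `^ (q - p))%:E * (`|v x| `^ p)%:E)%E.
  by apply: emeasurable_funM => //; exact: measurable_cst.
rewrite -ge0_integralD//; last 2 first.
- by move=> x _; rewrite lee_fin powR_ge0.
- by move=> x _; rewrite -EFinM lee_fin mulr_ge0 ?powR_ge0.
apply: ge0_le_integral => //.
- exact: measurable_powR_norm.
- apply: emeasurable_funD; first exact: measurable_cst.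
  by apply: emeasurable_funM => //; exact: measurable_cst.
- by move=> x _; rewrite -EFinM -EFinD lee_fin powR_le_split.
Qed.

(** Convergence in L^p implies convergence of the integrals of smaller powers:
    eta makes the first term of the splitting small, then k the second one. *)
Lemma int_powR_cvg0 (q : R) (h : nat -> 'rV[R]_n -> R) : 0 < q -> q <= p ->
  (forall k, measurable_fun Omega (h k)) ->
  Lp_norm p Omega (h k) @[k --> \oo] --> 0%E ->
  forall delta : R, 0 < delta -> \forall k \near \oo,
    (\int[leb n]_(x in Omega) (`|h k x| `^ q)%:E <= delta%:E)%E.
Proof.
move=> q0 qp mh hcvg delta d0.
pose eta := (delta / (2 * (a + 1))) `^ q^-1.
have a1 : 0 < a + 1 by rewrite ltr_wpDl.
have t0 : 0 < delta / (2 * (a + 1)) by rewrite divr_gt0// mulr_gt0.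
have eta0 : 0 < eta by exact: powR_gt0.
have etaq : eta `^ q = delta / (2 * (a + 1)).
  by rewrite /eta -powRrM mulVf ?gt_eqF// powRr1// ltW.
have K0 : 0 < eta `^ (q - p) by exact: powR_gt0.
have d20 : 0 < delta / 2 / eta `^ (q - p) by rewrite !divr_gt0.
near=> k.
apply: le_trans (int_powR_le_split q0 qp eta0 (mh k)) _.
have ek : (int_pow p Omega (h k) <= (delta / 2 / eta `^ (q - p))%:E)%E.
  by near: k; exact: int_pow_cvg0.
apply: (@le_trans _ _ ((eta `^ q * a)%:E +
  (eta `^ (q - p))%:E * (delta / 2 / eta `^ (q - p))%:E)%E).
  by apply: leeD2l; apply: lee_wpmul2l => //; rewrite lee_fin powR_ge0.
have K1 : eta `^ (q - p) * (delta / 2 / eta `^ (q - p)) = delta / 2.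
  by rewrite mulrC divfK// gt_eqF.
rewrite -EFinM -EFinD lee_fin etaq K1.
have : delta / (2 * (a + 1)) * a <= delta / 2.
  rewrite mulrAC ler_pdivrMr ?mulr_gt0// -mulrA ler_pM2l//.
  by rewrite mulKf ?lerDl.
by lra.
Unshelve. all: by end_near. Qed.

Lemma coord_derive i (x : 'rV[R]_n) :
  derivable (fun y : 'rV[R]_n => y ord0 i) x (delta_mx ord0 i) /\
  partial i (fun y : 'rV[R]_n => y ord0 i) x = 1.
Proof.
have h : h^-1 *: (((fun y : 'rV[R]_n => y ord0 i) \o shift x) (h *: delta_mx ord0 i)
    - x ord0 i) @[h --> (0:R)^'] --> (1 : R).
  apply: cvg_near_cst; near=> t.
  have t0 : t != 0 by near: t; exact: nbhs_dnbhs_neq.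
  by rewrite /= !mxE !eqxx mulr1 addrK /GRing.scale/= mulVf.
by split; [apply/cvg_ex; exists 1|exact: cvg_lim h].
Unshelve. all: by end_near. Qed.

(** Integration by parts against a coordinate bounds the integral of a test
    function by that of its gradient. *)
Lemma test_function_int_le i f (M : R) : test_function Omega f ->
  Omega `<=` cbox 0 M ->
  `|\int[leb n]_(x in Omega) f x| <= M * \int[leb n]_(x in Omega) `|partial i f x|.
Proof.
move=> tf OM.
have ipf : (leb n).-integrable Omega (EFin \o partial i f).
  have Wf := test_function_W01p p1 oO bO tf.
  have [[_ /(_ i) Lf _] _] := Wf.
  rewrite (_ : partial i f = fun x => grad f x ord0 i); first exact: (in_Lp_integrable p1 oO bO).
  by apply/funext => x; rewrite mxE.
have intf : (leb n).-integrable Omega (EFin \o f).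
  by have [[Lf _ _] _] := test_function_W01p p1 oO bO tf; exact: (in_Lp_integrable p1 oO bO).
pose phi (x : 'rV[R]_n) : R := x ord0 i * partial i f x.
have iphi : (leb n).-integrable Omega (EFin \o phi).
  apply: (le_integrable mO _ _ (integrableZl_EFin M mO ipf)).
    apply/measurable_EFinP/measurable_funM.
      exact: measurable_funTS (continuous_measurable_rV (@coord_continuous _ _ _ _ _)).
    exact: test_function_measurable_partial.
  move=> x Ox /=; rewrite lee_fin !normrM ler_wpM2r//.
  by have := OM x Ox i; rewrite mxE subr0 => /le_trans; apply; exact: ler_norm.
have parts : \int[leb n]_(x in Omega) phi x = - \int[leb n]_(x in Omega) f x.
  have := @integration_by_parts_test R n Omega (fun y => y ord0 i) f i.
  move=> /(_ (@coord_continuous _ _ _ _ _) (fun x => (coord_derive i x).1)).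
  rewrite (_ : partial i (fun y => y ord0 i) = cst 1); last first.
    by apply/funext => x; rewrite (coord_derive i x).2.
  move=> /(_ (@cst_continuous _ _ _) tf).
  under [in X in _ = X -> _]eq_integral do rewrite mul1r.
  by rewrite (integral_EFin mO iphi) (integral_EFin mO intf) -EFinN => -[].
rewrite -normrN -parts.
apply: le_trans (le_normr_Rintegral mO iphi) _.
rewrite -RintegralZl//; last exact: integrable_norm.
apply: le_Rintegral => //.
- exact: integrable_norm.
- by apply: (integrableZl_EFin M mO (g := fun x => `|partial i f x|)); exact: integrable_norm.
- move=> x Ox; rewrite normrM ler_wpM2r//.
  by have := OM x Ox i; rewrite mxE subr0.
Qed.

End approximation.

(** * Vanishing gradients, positivity, and limits at 0+ *)

Section gradient_and_sign.
Context {R : realType} {n : nat}.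
Variables (p : R) (Omega : set 'rV[R]_n).
Hypotheses (p1 : 1 < p) (oO : open Omega) (bO : bounded_set Omega).
Implicit Types (f psi v w : 'rV[R]_n -> R) (g : 'rV[R]_n -> 'rV[R]_n) (i : 'I_n).

Let mO : measurable Omega. Proof. exact: open_measurable_rV. Qed.
Let p0 : 0 < p. Proof. exact: lt_trans p1. Qed.

(** A function of W_0^{1,p} whose gradient vanishes has mean zero, because the
    integrals of the test functions approaching it are controlled by their
    gradients. *)
Lemma W01p_grad_eq0 i v g : W01p p Omega v g ->
  int_pow p Omega (fun x => enorm (g x)) = 0%E ->
  \int[leb n]_(x in Omega) v x = 0.
Proof.
move=> Wv g0; have [M M0 OM] := bounded_set_cbox bO.
have mv := W01p_measurable p1 oO Wv.
have [[Lv Lg _] [phi [tphi phiv phig]]] := Wv.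
have mg : measurable_fun Omega (fun x => enorm (g x)).
  by apply: measurable_enorm => j; exact: W01p_measurable_grad Wv.
have Lg0 : Lp_norm p Omega (fun x => enorm (g x)) = 0%E.
  by rewrite (Lp_normE Omega p1) g0 poweR0r// invr_eq0 gt_eqF.
have dphi0 : Lp_norm p Omega (partial i (phi k)) @[k --> \oo] --> 0%E.
  apply: (@squeeze_cvge _ _ _ _ (fun=> 0%E) _ _ _ _ (cvg_cst _) phig).
  apply: nearW => k; rewrite Lp_norm_ge0/=.
  rewrite -[leRHS]adde0 -Lg0.
  have md := measurable_grad_sub p1 oO (tphi k) Wv.
  apply: le_trans (Lp_normD p1 mO md mg).
  apply: le_Lp_norm => //.
  - exact: test_function_measurable_partial.
  - exact: measurable_funD.
  - move=> x _; rewrite [leRHS]ger0_norm ?addr_ge0 ?enorm_ge0//.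
    have := normr_coord_enorm (grad (phi k) x) i; rewrite mxE => /le_trans; apply.
    by rewrite -{1}(subrK (g x) (grad (phi k) x)) enormD.
have iv := in_Lp_integrable p1 oO bO Lv.
apply/eqP; rewrite -normr_le0; apply/ler_addgt0Pr => e e0; rewrite add0r.
have M1 : 0 < M + 1 by rewrite ltr_wpDl.
have d0 : 0 < e / (M + 1) by rewrite divr_gt0.
have mvphi k : measurable_fun Omega (fun x => phi k x - v x).
  by apply: measurable_funB => //; exact: test_function_measurable.
have := int_powR_cvg0 p1 oO bO ltr01 (ltW p1) mvphi phiv d0.
have := int_powR_cvg0 p1 oO bO ltr01 (ltW p1)
  (fun k => test_function_measurable_partial i (tphi k)) dphi0 d0.
move=> near1 near2; have [k _ kP] := filterI near1 near2.
have [/= h1 h2] := kP k (leqnn k).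
have tW := test_function_W01p p1 oO bO (tphi k).
have iphi : (leb n).-integrable Omega (EFin \o phi k).
  by have [[L _ _] _] := tW; exact: (in_Lp_integrable p1 oO bO L).
have idphi : (leb n).-integrable Omega (EFin \o partial i (phi k)).
  have [[_ /(_ i) L _] _] := tW; move: (in_Lp_integrable p1 oO bO L).
  by rewrite (_ : (fun _ => _) = partial i (phi k))//; apply/funext => x; rewrite mxE.
have isub := integrableB mO iphi iv.
have b1 : \int[leb n]_(x in Omega) `|partial i (phi k) x| <= e / (M + 1).
  rewrite -lee_fin -integral_EFin//; last exact: integrable_norm.
  apply: le_trans h1; rewrite le_eqVlt; apply/orP; left; apply/eqP.
  by apply: eq_integral => x _; rewrite (powRr1 (normr_ge0 _)).
have b2 : \int[leb n]_(x in Omega) `|phi k x - v x| <= e / (M + 1).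
  rewrite -lee_fin -integral_EFin//; last exact: integrable_norm.
  apply: le_trans h2; rewrite le_eqVlt; apply/orP; left; apply/eqP.
  by apply: eq_integral => x _; rewrite (powRr1 (normr_ge0 _)).
have -> : \int[leb n]_(x in Omega) v x = \int[leb n]_(x in Omega) phi k x -
    \int[leb n]_(x in Omega) (phi k x - v x).
  by rewrite RintegralB//; ring.
apply: le_trans (ler_normB _ _) _.
have c1 := test_function_int_le p1 oO bO i (tphi k) OM.
have c2 := le_normr_Rintegral mO isub.
apply: le_trans (lerD c1 c2) _.
have -> : e = M * (e / (M + 1)) + e / (M + 1) by field; rewrite gt_eqF.
by rewrite lerD// ler_wpM2l.
Qed.

(** An open set is a countable union of compact cubes. *)
Lemma ess_inf_on_pos_ae u :
  (forall K, compact K -> K `<=` Omega -> (0 < ess_inf_on K u)%E) ->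
  \forall x \ae leb n, Omega x -> 0 < u x.
Proof.
move=> uK; have [P [c [r OE]]] := open_bigcup_cbox oO.
have ae_k k : \forall x \ae leb n, P k -> cbox (c k) (r k) x -> 0 < u x.
  have [Pk|nPk] := pselect (P k); last by apply: nearW => x /nPk.
  have := uK _ (cbox_compact (c := c k) (r := r k)).
  have sub : cbox (c k) (r k) `<=` Omega by rewrite OE => x xk; exists k.
  move=> /(_ sub) pos;
  apply: filterS (ess_inf_le (leb n) (patch (cst +oo%E) (cbox (c k) (r k)) (EFin \o u))) => x.
  move=> h _ xk; move: (lt_le_trans pos h).
  by rewrite /patch mem_set//= lte_fin.
apply: filterS (ae_foralln ae_k) => x h; rewrite OE => -[k Pk xk].
exact: h xk.
Qed.

End gradient_and_sign.

(** The weighted inequality between the arithmetic and the geometric mean for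
    psi / u and u^(q/(1-q)) / m with weights q and 1 - q: the powers of u
    cancel in the geometric mean. *)
Lemma young_mean {R : realType} (psi u m q : R) : 0 <= psi -> 0 < u -> 0 < m ->
  0 < q < 1 ->
  psi `^ q <= m `^ (1 - q) * (q * (u^-1 * psi) + (1 - q) * (m^-1 * u `^ (q / (1 - q)))).
Proof.
move=> psi0 u0 m0 q01; have /andP[q0 q1] := q01.
have q10 : 0 < 1 - q by rewrite subr_gt0.
have h := @powR_amgm _ (u^-1 * psi) (m^-1 * u `^ (q / (1 - q))) q.
have x0 : 0 <= u^-1 * psi by rewrite mulr_ge0// invr_ge0 ltW.
have y0 : 0 <= m^-1 * u `^ (q / (1 - q)) by rewrite mulr_ge0 ?powR_ge0// invr_ge0 ltW.
have {h} := h x0 y0 q01.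
rewrite -(ler_pM2l (powR_gt0 (1 - q) m0)); apply: le_trans.
rewrite powRM ?invr_ge0 ?(ltW u0)// [X in _ * (_ * X)]powRM ?powR_ge0 ?invr_ge0 ?(ltW m0)//.
rewrite -[(u `^ _) `^ _]powRrM divfK ?gt_eqF//.
rewrite -(powR_inv1 (ltW u0)) -(powR_inv1 (ltW m0)) -!powRrM !mulN1r !powRN.
have U0 := powR_gt0 q u0; have M0 := powR_gt0 (1 - q) m0.
by rewrite le_eqVlt; apply/orP; left; apply/eqP; field; rewrite !gt_eqF.
Qed.

Lemma ae_pos_integral_neq0 d (T : measurableType d) {R : realType}
    (m : {measure set T -> \bar R}) (D : set T) (f : T -> R) :
  measurable D -> measurable_fun D f -> (0 < m D)%E ->
  (\forall x \ae m, D x -> 0 < f x) ->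
  (\int[m]_(x in D) `|(f x)%:E| != 0)%E.
Proof.
move=> mD mf D0 fpos; apply/eqP.
have mfE : measurable_fun D (EFin \o f) by exact/measurable_EFinP.
move/(ae_eq_integral_abs m mD mfE) => f0.
have : \forall x \ae m, D x -> False.
  apply: filterS2 fpos f0 => x h1 h2 Dx.
  by have := h1 Dx; have [->] := h2 Dx; rewrite ltxx.
move=> [N [mN N0 DN]]; have DsN : D `<=` N.
  by move=> x Dx; apply: DN => /=; apply/existsNP; exists Dx => -[].
have : (m D <= m N)%E by apply: le_measure; rewrite ?inE.
by rewrite N0 leNgt D0.
Qed.

Lemma cvg_ratio_at_right {R : realType} :
  q / (1 - q) @[q --> (0:R)^'+] --> (0:R)^'+.
Proof.
move=> A [/= d d0 dA]; suff : \forall q \near (0:R)^'+, A (q / (1 - q)) by [].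
near=> q.
have q0 : 0 < q by [].
have q2 : q < 2^-1 by near: q; apply: nbhs_right_lt; rewrite invr_gt0.
have qd : q < d / 2 by near: q; apply: nbhs_right_lt; rewrite divr_gt0.
have q1 : 0 < 1 - q by lra.
have r0 : 0 < q / (1 - q) by rewrite divr_gt0.
apply: dA => //=; rewrite sub0r normrN (gtr0_norm r0) ltr_pdivrMr//.
by nra.
Unshelve. all: by end_near. Qed.

Section geometric_mean.
Context {R : realType} {n : nat}.
Variables (p : R) (Omega : set 'rV[R]_n).
Hypotheses (p1 : 1 < p) (oO : open Omega) (bO : bounded_set Omega)
  (O0 : Omega !=set0).

Let mO : measurable Omega. Proof. exact: open_measurable_rV. Qed.
Let p0 : 0 < p. Proof. exact: lt_trans p1. Qed.

Let a := fine (leb n Omega).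

Let aE : leb n Omega = a%:E.
Proof. exact: leb_fineK. Qed.

Let a0 : 0 < a. Proof. by rewrite -lte_fin -aE leb_open_gt0. Qed.

(** Encoded as a real number, equal to 0 when the integral of log |v| is -oo;
    that integral is never +oo for an integrable v. *)
Definition geometric_mean (v : 'rV[R]_n -> R) : R :=
  fine (expeR (mean_log (leb n) Omega (fine (leb n Omega)) (fun x => `|v x|))).

Lemma geometric_mean_ge0 v : 0 <= geometric_mean v.
Proof. exact/fine_ge0/expeR_ge0. Qed.

Let integrable_norm_W01p v : in_W01p p Omega v ->
  (leb n).-integrable Omega (EFin \o (fun x => `|v x|)).
Proof.
move=> [h [[Lv _ _] _]]; apply: integrable_norm.
exact: (in_Lp_integrable p1 oO bO Lv).
Qed.

Lemma power_mean_cvg_geometric_mean v : in_W01p p Omega v ->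
  power_mean (leb n) Omega a (fun x => `|v x|) q @[q --> 0^'+] -->
  geometric_mean v.
Proof.
move=> /integrable_norm_W01p iv.
exact: (power_mean_cvg mO a0 aE (fun x _ => normr_ge0 (v x)) iv).
Qed.

Lemma geometric_mean_eq1 v : in_W01p p Omega v ->
  geometric_mean v = 1 <-> int_log Omega v = 0%E.
Proof.
move=> /integrable_norm_W01p iv.
have := mean_log_lty mO a0 aE (fun x _ => normr_ge0 (v x)) iv.
have mlE : mean_log (leb n) Omega a (fun x => `|v x|) =
    (int_log Omega v * (a^-1)%:E)%E by [].
have aV : (a^-1)%:E != 0%E by rewrite eqe invr_eq0 gt_eqF.
have -> : int_log Omega v = 0%E <-> mean_log (leb n) Omega a (fun x => `|v x|) = 0%E.
  rewrite mlE; split => [->|/eqP]; first by rewrite mul0e.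
  by rewrite mule_eq0 (negbTE aV) orbF => /eqP.
rewrite /geometric_mean -/a.
case: (mean_log _ _ _ _) => [r _||] //=.
  split => [|[->]]; last by rewrite expR0.
  by rewrite -expR0 => /expR_inj ->.
by move=> _; split => // /eqP; rewrite eq_sym oner_eq0.
Qed.

Lemma calM_geometric_mean v : in_W01p p Omega v ->
  calM p Omega v <-> geometric_mean v = 1.
Proof.
move=> Wv; have iv := integrable_norm_W01p Wv.
have cv := power_mean_cvg_geometric_mean Wv.
pose F (q : R) : \bar R := (((\int[leb n]_(x in Omega) (`|v x| `^ q)%:E) / leb n Omega) `^ q^-1)%E.
have cF : F q @[q --> 0^'+] --> (geometric_mean v)%:E.
  apply: (@cvg_trans _ ((power_mean (leb n) Omega a (fun x => `|v x|) q)%:E @[q --> 0^'+])).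
    apply: near_eq_cvg; near=> q.
    have q01 : 0 < q <= 1.
      by apply/andP; split => //; near: q; exact: nbhs_right_le.
    rewrite /F aE (integral_EFin mO (integrable_powR mO aE (fun x _ => normr_ge0 (v x)) iv q01)).
    by rewrite inver gt_eqF// -EFinM poweR_EFin.
  by apply: cvg_EFin => //; exact: nearW.
split.
  move=> [_ cv1].
  have : (geometric_mean v)%:E = 1%E by exact: (cvg_unique _ cF cv1).
  by case.
move=> g1; split => //; move: cF; rewrite g1; exact.
Unshelve. all: by end_near. Qed.

End geometric_mean.

(** * The equation satisfied by the solution *)

Section weak_solution.
Context {R : realType} {n : nat}.
Variables (p : R) (Omega : set 'rV[R]_n).
Hypotheses (p1 : 1 < p) (oO : open Omega) (bO : bounded_set Omega).
Implicit Types (f psi v w : 'rV[R]_n -> R).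

Let mO : measurable Omega. Proof. exact: open_measurable_rV. Qed.
Let p0 : 0 < p. Proof. exact: lt_trans p1. Qed.

Variables (l : R) (u : 'rV[R]_n -> R) (g : 'rV[R]_n -> 'rV[R]_n).
Hypotheses (Wu : W01p p Omega u g)
  (upos : \forall x \ae leb n, Omega x -> 0 < u x)
  (eqn : forall phi gphi, W01p p Omega phi gphi ->
    (\int[leb n]_(x in Omega)
       (enorm (g x) `^ (p - 2) * dot (g x) (gphi x))%:E =
     l%:E * \int[leb n]_(x in Omega) ((u x)^-1 * phi x)%:E)%E).

Let a := fine (leb n Omega).

Let aE : leb n Omega = a%:E.
Proof. exact: leb_fineK. Qed.

Let mu_ : measurable_fun Omega u. Proof. exact: W01p_measurable Wu. Qed.

Let mg : measurable_fun Omega (fun x => enorm (g x)).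
Proof. by apply: measurable_enorm => j; exact: W01p_measurable_grad Wu. Qed.

Let measurable_inv_norm_u : measurable_fun Omega (fun x => `|u x|^-1).
Proof. exact: measurable_fun_inv_norm. Qed.

Let measurable_inv_u : measurable_fun Omega (fun x => (u x)^-1).
Proof. exact: measurable_fun_inv. Qed.

(** The solution itself as test function; u^-1 u = 1 almost everywhere. *)
Lemma weak_solution_energy : int_pow p Omega (fun x => enorm (g x)) = (l * a)%:E.
Proof.
have := eqn Wu.
have -> : (\int[leb n]_(x in Omega) ((u x)^-1 * u x)%:E = a%:E)%E.
  rewrite (ae_eq_integral (cst 1%E)) ?integral_cst ?mul1e//.
  - by apply/measurable_EFinP/measurable_funM.
  - by apply: filterS upos => x h Ox /=; rewrite mulVf// gt_eqF// h.
rewrite -EFinM => <-; apply: eq_integral => x _; congr (_%:E).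
rewrite -enorm_sqr ger0_norm ?enorm_ge0//.
have [->|e0] := eqVneq (enorm (g x)) 0; first by rewrite expr0n mulr0 powR0 ?gt_eqF.
by rewrite -(powR_mulrn 2 (enorm_ge0 _)) -powRD ?subrK// e0 implybT.
Qed.

Hypotheses (l0 : 0 < l) (O0 : Omega !=set0).

Let a0 : 0 < a. Proof. by rewrite -lte_fin -aE leb_open_gt0. Qed.

Let energy_grad_lty f : test_function Omega f ->
  (int_pow p Omega (fun x => enorm (grad f x)) < +oo)%E.
Proof.
move=> tf; have [K KP] := choice (fun i => test_function_partial_bounded i tf).
have L : in_Lp p Omega (fun x => enorm (grad f x)).
  apply: (in_Lp_bounded p1 oO bO (measurable_enorm_grad tf)
    (K := Num.sqrt (\sum_i K i ^+ 2))) => x _.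
  rewrite (ger0_norm (enorm_ge0 _)); apply: ler_wsqrtr; apply: ler_sum => i _.
  by rewrite mxE -expr2 -real_normK ?num_real// ler_sqr ?nnegrE ?(le_trans _ (KP i x)).
by have /(in_LpP p1 mO)[] := L.
Qed.

(** Testing the equation with f and Young's inequality
    |g|^(p-1) |grad f| <= (1 - 1/p) |g|^p + (1/p) |grad f|^p. *)
Lemma weak_solution_test_le f : test_function Omega f ->
  (forall x, 0 <= f x) ->
  (l%:E * \int[leb n]_(x in Omega) (`|u x|^-1 * f x)%:E <=
   ((1 - p^-1) * (l * a))%:E +
   (p^-1)%:E * int_pow p Omega (fun x => enorm (grad f x)))%E.
Proof.
move=> tf f0; have Wf := test_function_W01p p1 oO bO tf.
have pV0 : 0 < p^-1 by rewrite invr_gt0.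
have pV1 : p^-1 < 1 by rewrite invf_lt1.
have mdf := measurable_enorm_grad tf.
pose young (x : 'rV[R]_n) : R := (1 - p^-1) * `|enorm (g x)| `^ p + p^-1 * `|enorm (grad f x)| `^ p.
pose lhs (x : 'rV[R]_n) : R := enorm (g x) `^ (p - 2) * dot (g x) (grad f x).
have lhs_young x : `|lhs x| <= young x.
  rewrite /young !(ger0_norm (enorm_ge0 _)).
  have cs : `|dot (g x) (grad f x)| <= enorm (g x) * enorm (grad f x).
    rewrite ler_norml dot_le_enorm andbT lerNl.
    have := dot_le_enorm ((-1) *: g x) (grad f x).
    by rewrite dotZl enormZ normrN1 mulN1r mul1r.
  rewrite /lhs normrM (ger0_norm (powR_ge0 _ _)).
  apply: le_trans (ler_wpM2l (powR_ge0 _ _) cs) _.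
  have [->|e0] := eqVneq (enorm (g x)) 0.
    rewrite mul0r mulr0; apply: addr_ge0; apply: mulr_ge0; try exact: powR_ge0.
      by rewrite subr_ge0 ltW.
    exact: ltW.
  have pV01 : 0 < p^-1 < 1 by rewrite pV0.
  have := powR_amgm (powR_ge0 (enorm (grad f x)) p) (powR_ge0 (enorm (g x)) p) pV01.
  rewrite -!powRrM (divff (lt0r_neq0 p0)) (powRr1 (enorm_ge0 _)).
  have -> : enorm (g x) `^ (p * (1 - p^-1)) = enorm (g x) * enorm (g x) `^ (p - 2).
    rewrite -{2}(powRr1 (enorm_ge0 (g x))) -powRD; last by rewrite e0 implybT.
    by congr (_ `^ _); field; rewrite gt_eqF.
  move: (enorm (g x) `^ p) (enorm (grad f x) `^ p) (enorm (g x) `^ (p - 2)).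
  move: (enorm (g x)) (enorm (grad f x)) (p^-1) => G H t A B P.
  lra.
have iyoung : (leb n).-integrable Omega (EFin \o young).
  have igp : (leb n).-integrable Omega (fun x => (`|enorm (g x)| `^ p)%:E).
    apply/integrableP; split; first exact: measurable_powR_norm.
    under eq_integral do rewrite gee0_abs ?lee_fin ?powR_ge0//.
    by rewrite -[ltLHS]/(int_pow p Omega (fun x => enorm (g x))) weak_solution_energy ltry.
  have ifp : (leb n).-integrable Omega (fun x => (`|enorm (grad f x)| `^ p)%:E).
    apply/integrableP; split; first exact: measurable_powR_norm.
    under eq_integral do rewrite gee0_abs ?lee_fin ?powR_ge0//.
    exact: energy_grad_lty.
  exact: (integrableD mO (integrableZl mO (1 - p^-1) igp) (integrableZl mO p^-1 ifp)).
have mlhs : measurable_fun Omega lhs.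
  apply: measurable_funM.
    exact: measurable_fun_powR.
  apply: measurable_sum => j; apply: measurable_funM; first exact: W01p_measurable_grad Wu.
  exact: W01p_measurable_grad Wf.
have ilhs : (leb n).-integrable Omega (EFin \o lhs).
  apply: (le_integrable mO _ _ iyoung); first exact/measurable_EFinP.
  by move=> x _ /=; rewrite lee_fin; apply: le_trans (lhs_young x) (ler_norm _).
have -> : (\int[leb n]_(x in Omega) (`|u x|^-1 * f x)%:E =
    \int[leb n]_(x in Omega) ((u x)^-1 * f x)%:E)%E.
  apply: ae_eq_integral => //.
  - apply/measurable_EFinP/measurable_funM; last exact: test_function_measurable.
    exact: measurable_inv_norm_u.
  - apply/measurable_EFinP/measurable_funM => //; exact: test_function_measurable.
  - by apply: filterS upos => x h Ox /=; rewrite gtr0_norm// h.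
rewrite -(eqn Wf); apply: (@le_trans _ _ (\int[leb n]_(x in Omega) (young x)%:E)%E).
  apply: le_integral => // x _; rewrite lee_fin.
  exact: le_trans (ler_norm _) (lhs_young x).
pose h1 x : \bar R := ((1 - p^-1)%:E * (`|enorm (g x)| `^ p)%:E)%E.
pose h2 x : \bar R := ((p^-1)%:E * (`|enorm (grad f x)| `^ p)%:E)%E.
have mh1 : measurable_fun Omega h1.
  by apply: emeasurable_funM; [exact: measurable_cst|exact: measurable_powR_norm].
have mh2 : measurable_fun Omega h2.
  by apply: emeasurable_funM; [exact: measurable_cst|exact: measurable_powR_norm].
have q0 : (0 <= (1 - p^-1)%:E)%E by rewrite lee_fin subr_ge0 ltW.
have q0' : (0 <= (p^-1)%:E)%E by rewrite lee_fin ltW.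
have h10 x : Omega x -> (0 <= h1 x)%E.
  by move=> _; apply: mule_ge0 => //; rewrite lee_fin powR_ge0.
have h20 x : Omega x -> (0 <= h2 x)%E.
  by move=> _; apply: mule_ge0 => //; rewrite lee_fin powR_ge0.
rewrite (_ : (\int[leb n]_(x in Omega) (young x)%:E =
    \int[leb n]_(x in Omega) (h1 x + h2 x))%E)//.
rewrite (ge0_integralD _ mO h10 mh1 h20 mh2) EFinM -weak_solution_energy /h1 /h2.
have m1 := measurable_powR_norm p mg.
have m2 := measurable_powR_norm p mdf.
rewrite (ge0_integralZl _ mO m1 _ q0); last by move=> x _; rewrite lee_fin powR_ge0.
by rewrite (ge0_integralZl _ mO m2 _ q0')// => x _; rewrite lee_fin powR_ge0.
Qed.

(** * The solution minimizes the energy *)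

Let inu : (leb n).-integrable Omega (EFin \o (fun x => `|u x|)).
Proof.
apply: integrable_norm; have [[Lu _ _] _] := Wu.
exact: (in_Lp_integrable p1 oO bO Lu).
Qed.

Definition mean_pow r := \int[leb n]_(x in Omega) (`|u x| `^ r) / a.

Let ipow (r : R) : 0 < r <= 1 ->
  (leb n).-integrable Omega (EFin \o (fun x => `|u x| `^ r)).
Proof. by move=> r01; apply: (integrable_powR mO aE) => // x _. Qed.

Lemma mean_pow_gt0 (r : R) : 0 < r <= 1 -> 0 < mean_pow r.
Proof.
move=> r01; rewrite divr_gt0// lt_neqAle eq_sym; apply/andP; split; last first.
  by apply: Rintegral_ge0 => x _; exact: powR_ge0.
have mpow : measurable_fun Omega (fun x => `|u x| `^ r).
  by apply/measurable_EFinP; exact: measurable_int (ipow r01).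
have leb0 : (0 < leb n Omega)%E by rewrite aE lte_fin.
have pos : \forall x \ae leb n, Omega x -> 0 < `|u x| `^ r.
  by apply: filterS upos => x h Ox; rewrite powR_gt0// normr_gt0 gt_eqF// h.
have := ae_pos_integral_neq0 mO mpow leb0 pos.
under eq_integral do rewrite gee0_abs ?lee_fin ?powR_ge0//.
by rewrite (integral_EFin mO (ipow r01)).
Qed.

Let ratio_r (q : R) : 0 < q <= 2^-1 -> 0 < q / (1 - q) <= 1.
Proof.
move=> /andP[q0 q2]; have q1 : 0 < 1 - q by lra.
by rewrite divr_gt0//= ler_pdivrMr//; lra.
Qed.

(** Integrating young_mean with m the mean of u^(q/(1-q)): the last term becomes
    (1 - q) |Omega|. *)
Lemma int_powR_le_mean (q : R) psi : 0 < q <= 2^-1 ->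
  measurable_fun Omega psi -> (forall x, 0 <= psi x) ->
  (\int[leb n]_(x in Omega) (`|psi x| `^ q)%:E <=
   (mean_pow (q / (1 - q)) `^ (1 - q))%:E *
    (q%:E * \int[leb n]_(x in Omega) (`|u x|^-1 * psi x)%:E + ((1 - q) * a)%:E))%E.
Proof.
move=> q2 mpsi psi0; have /andP[q0 q12] := q2.
have q1 : 0 < 1 - q by lra.
set r := q / (1 - q); have r01 : 0 < r <= 1 by exact: ratio_r.
set m := mean_pow r; have m0 : 0 < m by exact: mean_pow_gt0.
set c := m `^ (1 - q); have c0 : 0 < c by exact: powR_gt0.
pose h1 (x : 'rV[R]_n) : \bar R := (`|u x|^-1 * psi x)%:E.
pose h2 (x : 'rV[R]_n) : \bar R := (`|u x| `^ r)%:E.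
have mh1 : measurable_fun Omega h1 by apply/measurable_EFinP/measurable_funM.
have mh2 : measurable_fun Omega h2 by exact: measurable_int (ipow r01).
have h10 x : Omega x -> (0 <= h1 x)%E.
  by move=> _; rewrite lee_fin mulr_ge0// invr_ge0.
have h20 x : Omega x -> (0 <= h2 x)%E by move=> _; rewrite lee_fin powR_ge0.
have qE0 : (0 <= q%:E)%E by rewrite lee_fin ltW.
have kE0 : (0 <= ((1 - q) * m^-1)%:E)%E.
  by rewrite lee_fin mulr_ge0 ?invr_ge0 ?(ltW m0) ?(ltW q1).
have cE0 : (0 <= c%:E)%E by rewrite lee_fin ltW.
have int2 : (\int[leb n]_(x in Omega) h2 x = (m * a)%:E)%E.
  rewrite /h2 (integral_EFin mO (ipow r01)) /m /mean_pow divfK//.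
  by rewrite gt_eqF.
pose k1 x := (q%:E * h1 x)%E.
pose k2 x := (((1 - q) * m^-1)%:E * h2 x)%E.
have mk1 : measurable_fun Omega k1 by apply: emeasurable_funM => //; exact: measurable_cst.
have mk2 : measurable_fun Omega k2 by apply: emeasurable_funM => //; exact: measurable_cst.
have k10 x : Omega x -> (0 <= k1 x)%E by move=> Ox; apply: mule_ge0 => //; exact: h10.
have k20 x : Omega x -> (0 <= k2 x)%E by move=> Ox; apply: mule_ge0 => //; exact: h20.
have mk : measurable_fun Omega (fun x => k1 x + k2 x)%E by exact: emeasurable_funD.
have k0 x : Omega x -> (0 <= k1 x + k2 x)%E.
  by move=> Ox; rewrite adde_ge0 ?k10 ?k20.
have -> : (c%:E * (q%:E * \int[leb n]_(x in Omega) (`|u x|^-1 * psi x)%:E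
      + ((1 - q) * a)%:E) = \int[leb n]_(x in Omega) (c%:E * (k1 x + k2 x)))%E.
  rewrite (ge0_integralZl _ mO mk k0 cE0); congr (_ * _)%E.
  rewrite (ge0_integralD _ mO k10 mk1 k20 mk2) /k1 /k2.
  rewrite (ge0_integralZl _ mO mh1 h10 qE0) (ge0_integralZl _ mO mh2 h20 kE0).
  by rewrite int2 -EFinM; congr (_ + _%:E)%E; rewrite -mulrA mulKf// gt_eqF.
apply: ae_ge0_le_integral => //.
- exact: measurable_powR_norm.
- by move=> x Ox; apply: mule_ge0 => //; exact: k0.
- by apply: emeasurable_funM => //; exact: measurable_cst.
apply: filterS upos => x h Ox;
rewrite -[leRHS]/((c * (q * (`|u x|^-1 * psi x) + (1 - q) * m^-1 * `|u x| `^ r))%:E) lee_fin.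
rewrite (gtr0_norm (h Ox)) (ger0_norm (psi0 x)) -mulrA.
by apply: young_mean => //; [exact: h|rewrite q0; lra].
Qed.

(** If the energy X of w were less than l |Omega|, then test functions psi close
    to |w| would have energy at most some Y < l |Omega|.  By
    weak_solution_test_le the integral of psi / u would then be less than
    |Omega| by a fixed amount, whereas by int_powR_le_mean and the normalization
    of w it exceeds |Omega| - d for every d > 0 when psi is close enough. *)
Lemma weak_solution_minimal (q : R) w gw : 0 < q <= 2^-1 -> W01p p Omega w gw ->
  (\int[leb n]_(x in Omega) (`|w x| `^ q)%:E =
    (mean_pow (q / (1 - q)) `^ (1 - q) * a)%:E)%E ->
  ((l * a)%:E <= int_pow p Omega (fun x => enorm (gw x)))%E.
Proof.
move=> q2 Ww intw; have /andP[q0 q12] := q2.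
have q1 : q <= 1 by lra.
have qp : q <= p by exact: le_trans (ltW p1).
set c := mean_pow (q / (1 - q)) `^ (1 - q) in intw *.
have c0 : 0 < c by apply/powR_gt0/mean_pow_gt0/ratio_r.
have la0 : 0 < l * a by exact: mulr_gt0.
have pV0 : 0 < p^-1 by rewrite invr_gt0.
have [_ [phi [tphi phiw phig]]] := Ww.
have mw := W01p_measurable p1 oO Ww.
have mgw : measurable_fun Omega (fun x => enorm (gw x)).
  by apply: measurable_enorm => j; exact: W01p_measurable_grad Ww.
have mdiff k : measurable_fun Omega (fun x => phi k x - w x).
  by apply: measurable_funB => //; exact: test_function_measurable.
rewrite leNgt; apply/negP => contra.
have Efin : int_pow p Omega (fun x => enorm (gw x)) \is a fin_num.
  by rewrite ge0_fin_numE ?int_pow_ge0// (lt_trans contra)// ltry.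
pose X := fine (int_pow p Omega (fun x => enorm (gw x))).
have XE : int_pow p Omega (fun x => enorm (gw x)) = X%:E by rewrite fineK.
have X0 : 0 <= X by exact/fine_ge0/int_pow_ge0.
have Xla : X < l * a by rewrite -lte_fin -XE.

pose Y := (X + l * a) / 2.
have XY : X < Y by rewrite /Y; lra.
have Yla : Y < l * a by rewrite /Y; lra.
have Y0 : 0 < Y by exact: le_lt_trans XY.
have rootXY : X `^ p^-1 < Y `^ p^-1.
  by apply: gt0_ltr_powR => //; rewrite nnegrE// ltW.
(* The loss 2 delta / q below is half of (l a - Y) / (p l a), the amount by which
   the integral of psi / u falls short of a, relative to a. *)
pose delta := q * (l * a - Y) / (4 * p * (l * a)).
have delta0 : 0 < delta.
  by rewrite divr_gt0 ?mulr_gt0// subr_gt0.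
pose gap := c * a * delta.
have gap0 : 0 < gap by apply: mulr_gt0 => //; exact: mulr_gt0.
have near1 := int_powR_cvg0 p1 oO bO q0 qp mdiff phiw gap0.
have rgap : 0 < Y `^ p^-1 - X `^ p^-1 by rewrite subr_gt0.
have near2 : \forall k \near \oo,
    (Lp_norm p Omega (fun x => enorm (grad (phi k) x - gw x)) <=
     (Y `^ p^-1 - X `^ p^-1)%:E)%E.
  move/fine_cvgP : phig => [hfin hcvg]; near=> k.
  rewrite -(@fineK _ (Lp_norm _ _ _)); last by near: k.
  rewrite lee_fin; apply/ltW; near: k; exact: (cvgr_lt _ hcvg).
have [k _ kP] := filterI near1 near2.
have [/= h1 h2] := kP k (leqnn k).
have [sphi _ _] := tphi k.
have energy_phi : (int_pow p Omega (fun x => enorm (grad (phi k) x)) <= Y%:E)%E.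
  have md := measurable_grad_sub p1 oO (tphi k) Ww.
  have : (Lp_norm p Omega (fun x => enorm (grad (phi k) x)) <= (Y `^ p^-1)%:E)%E.
    apply: (@le_trans _ _ (Lp_norm p Omega
        (fun x => enorm (grad (phi k) x - gw x) + enorm (gw x)))).
      apply: le_Lp_norm => //.
      - exact: measurable_enorm_grad.
      - exact: measurable_funD.
      - move=> x _; rewrite !ger0_norm ?addr_ge0 ?enorm_ge0//.
        by rewrite -{1}(subrK (gw x) (grad (phi k) x)) enormD.
    apply: le_trans (Lp_normD p1 mO md mgw) _.
    rewrite [X in (_ + X <= _)%E](Lp_normE Omega p1) XE poweR_EFin.
    rewrite -[leRHS]/((Y `^ p^-1)%:E) -(subrK (X `^ p^-1) (Y `^ p^-1)) EFinD.
    exact: leeD2r.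
  move=> h; rewrite -(Lp_norm_powR Omega p1).
  have -> : Y%:E = ((Y `^ p^-1)%:E `^ p)%E.
    by rewrite poweR_EFin -powRrM mulVf ?gt_eqF// powRr1// ltW.
  apply: (gt0_ler_poweR (ltW p0)); rewrite ?in_itv/= ?Lp_norm_ge0 ?leey//.
  by rewrite lee_fin powR_ge0.
pose e := (c * delta) `^ q^-1.
have e0 : 0 < e by apply: powR_gt0; exact: mulr_gt0.
have eq : e `^ q = c * delta.
  by rewrite /e -powRrM mulVf ?gt_eqF// powRr1// ltW// mulr_gt0.
(* The regularization parameter e satisfies e^q |Omega| = gap. *)
have [psi [tpsi psi0 phi_psi grad_psi]] : exists psi, [/\ test_function Omega psi,
    forall x, 0 <= psi x, forall x, `|phi k x| <= psi x + e &
    forall x, enorm (grad psi x) <= enorm (grad (phi k) x)].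
  exists (regabs e (phi k)); split.
  - exact: test_function_regabs.
  - by move=> x; exact: regabs_ge0.
  - by move=> x; exact: normr_le_regabs.
  - by move=> x; exact: enorm_grad_regabs.
have mpsi := test_function_measurable tpsi.
have energy_psi : (int_pow p Omega (fun x => enorm (grad psi x)) <= Y%:E)%E.
  apply: le_trans energy_phi; apply: (le_int_pow p1 mO).
  - exact: measurable_enorm_grad.
  - exact: measurable_enorm_grad.
  - by move=> x _; rewrite !(ger0_norm (enorm_ge0 _)); exact: grad_psi.
pose I := (\int[leb n]_(x in Omega) (`|u x|^-1 * psi x)%:E)%E.
have upper := weak_solution_test_le tpsi psi0.
have I0 : (0 <= I)%E.
  by apply: integral_ge0 => x _; rewrite lee_fin mulr_ge0// invr_ge0.
have upper' : (l%:E * I <= ((1 - p^-1) * (l * a) + p^-1 * Y)%:E)%E.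
  apply: le_trans upper _; rewrite EFinD EFinM; apply: leeD2l.
  by rewrite EFinM; apply: lee_wpmul2l => //; rewrite lee_fin ltW.
have Ifin : I \is a fin_num.
  rewrite ge0_fin_numE// ltNge leye_eq; apply/negP => /eqP Iy.
  by move: upper'; rewrite Iy gt0_muley ?lte_fin// leye_eq.
have IE : I = (fine I)%:E by rewrite fineK.
rewrite IE -EFinM lee_fin in upper'.
have lower : (\int[leb n]_(x in Omega) (`|w x| `^ q)%:E <=
    \int[leb n]_(x in Omega) (`|psi x| `^ q)%:E + gap%:E + gap%:E)%E.
  have gapE : gap%:E = (\int[leb n]_(x in Omega) cst (e `^ q)%:E x)%E.
    by rewrite (integral_cst _ mO) aE eq -EFinM /gap; congr (_%:E); ring.
  apply: (@le_trans _ _ (\int[leb n]_(x in Omega) (`|psi x| `^ q)%:E + gap%:E +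
     \int[leb n]_(x in Omega) (`|phi k x - w x| `^ q)%:E)%E); last exact: leeD2l.
  have m1 := measurable_powR_norm q mpsi.
  have m2 := measurable_powR_norm q (mdiff k).
  have m3 : measurable_fun Omega (cst (e `^ q)%:E) by exact: measurable_cst.
  have m13 : measurable_fun Omega (fun x => (`|psi x| `^ q)%:E + cst (e `^ q)%:E x)%E.
    exact: emeasurable_funD.
  have pow0 (v : 'rV[R]_n -> R) x : Omega x -> (0 <= (`|v x| `^ q)%:E)%E.
    by move=> _; rewrite lee_fin powR_ge0.
  have e0' (x : 'rV[R]_n) : Omega x -> (0 <= cst (e `^ q)%:E x)%E.
    by move=> _; rewrite lee_fin powR_ge0.
  have n13 x : Omega x -> (0 <= (`|psi x| `^ q)%:E + cst (e `^ q)%:E x)%E.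
    by move=> Ox; rewrite adde_ge0 ?e0' ?pow0.
  rewrite gapE -(ge0_integralD _ mO (pow0 psi) m1 e0' m3).
  rewrite -(ge0_integralD _ mO n13 m13 (pow0 (fun x => phi k x - w x)) m2).
  apply: (ge0_le_integral _ mO (pow0 w)).
  - exact: measurable_powR_norm.
  - exact: emeasurable_funD.
  - move=> x _; rewrite -!EFinD lee_fin.
    have q01 : 0 < q <= 1 by rewrite q0.
    apply: (@le_trans _ _ ((`|psi x| + e) `^ q + `|phi k x - w x| `^ q)).
      apply: (@le_trans _ _ ((`|psi x| + e + `|phi k x - w x|) `^ q)).
        apply: ge0_ler_powR; rewrite ?nnegrE ?(ltW q0) ?addr_ge0 ?(ltW e0)//.
        have := phi_psi x; rewrite (ger0_norm (psi0 x)) => h.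
        have := ler_normB (phi k x) (phi k x - w x); rewrite subKr => /le_trans; apply.
        by rewrite lerD2r.
      by apply: powR_subadditive; rewrite ?addr_ge0 ?(ltW e0).
    by rewrite lerD2r powR_subadditive ?(ltW e0).
have mid := int_powR_le_mean q2 mpsi psi0.
rewrite -/I IE -/c in mid.
have := le_trans lower (leeD (leeD mid (lexx gap%:E)) (lexx gap%:E)).
rewrite intw -[leRHS]/((c * (q * fine I + (1 - q) * a) + gap + gap)%:E) lee_fin.
rewrite /gap => fin_ineq.
have ineq : a * (1 - 2 * delta / q) <= fine I.
  have {}fin_ineq : c * a <= c * (q * fine I + (1 - q) * a + a * delta + a * delta).
    by move: fin_ineq; lra.
  rewrite ler_pM2l// in fin_ineq.
  rewrite -(ler_pM2l q0) (_ : q * _ = q * a - 2 * a * delta); first lra.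
  by field; rewrite gt_eqF.
have : l * (a * (1 - 2 * delta / q)) <= (1 - p^-1) * (l * a) + p^-1 * Y.
  by apply: le_trans upper'; rewrite ler_pM2l.
rewrite (_ : l * _ = l * a - p^-1 * (l * a - Y) / 2); last first.
  by rewrite /delta; field; rewrite ?gt_eqF.
have : 0 < p^-1 * (l * a - Y) by rewrite mulr_gt0// subr_gt0.
lra.
Unshelve. all: by end_near. Qed.

(** * The constants lambda_q and mu *)

Let int_pow_enorm (h : 'rV[R]_n -> 'rV[R]_n) :
  int_pow p Omega (fun x => enorm (h x)) =
  (\int[leb n]_(x in Omega) (enorm (h x) `^ p)%:E)%E.
Proof. by apply: eq_integral => x _; rewrite (ger0_norm (enorm_ge0 _)). Qed.

Let int_powZ_grad (t : R) v h : 0 < t -> W01p p Omega v h ->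
  int_pow p Omega (fun x => enorm (t *: h x)) =
  ((t `^ p)%:E * int_pow p Omega (fun x => enorm (h x)))%E.
Proof.
move=> t0 Wv; have mh : measurable_fun Omega (fun x => enorm (h x)).
  by apply: measurable_enorm => j; exact: W01p_measurable_grad Wv.
have := int_powZ p mO t mh; rewrite (gtr0_norm t0) => <-.
by congr int_pow; apply/funext => x; rewrite enormZ (gtr0_norm t0).
Qed.

(** The quantity whose limit at 0 is mu. *)
Definition lambda_scaled (q : R) : \bar R :=
  (lambda p Omega q * leb n Omega `^ (p / q))%E.

Let lebE (q : R) : (leb n Omega `^ (p / q) = (a `^ (p / q))%:E)%E.
Proof. by rewrite aE poweR_EFin. Qed.

(** A competitor v is scaled by t so that its q-th power has the integral
    required by weak_solution_minimal. *)
Lemma lambda_scaled_ge (q : R) : 0 < q <= 2^-1 ->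
  ((l * a * (power_mean (leb n) Omega a (fun x => `|u x|) (q / (1 - q))) `^ (- p))%:E
   <= lambda_scaled q)%E.
Proof.
move=> q2; have /andP[q0 q12] := q2.
have q1 : 0 < 1 - q by lra.
set r := q / (1 - q).
have r01 : 0 < r <= 1 by rewrite /r divr_gt0//= ler_pdivrMr//; lra.
have mr0 := mean_pow_gt0 r01.
pose c := mean_pow r `^ (1 - q); have c0 : 0 < c by exact: powR_gt0.
pose t := (c * a) `^ q^-1; have t0 : 0 < t by apply: powR_gt0; exact: mulr_gt0.
have tq : t `^ q = c * a.
  by rewrite /t -powRrM mulVf ?gt_eqF// powRr1// ltW// mulr_gt0.
have lam : ((l * a * t `^ (- p))%:E <= lambda p Omega q)%E.
  apply: le_ereal_inf_tmp => _ [v [h [Wv intv ->]]].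
  have mv := W01p_measurable p1 oO Wv.
  have Wtv := W01pZ p1 oO bO t Wv.
  have inttv : (\int[leb n]_(x in Omega) (`|t * v x| `^ q)%:E = (c * a)%:E)%E.
    rewrite -[LHS]/(int_pow q Omega (fun x => t * v x)) (int_powZ q mO t mv) /int_pow intv.
    by rewrite mule1 (gtr0_norm t0) tq.
  have := weak_solution_minimal q2 Wtv inttv.
  rewrite (int_powZ_grad t0 Wv) -int_pow_enorm => h1.
  have tp0 : 0 < t `^ p by exact: powR_gt0.
  have tN0 : (0 <= (t `^ (- p))%:E)%E by rewrite lee_fin powR_ge0.
  have := lee_wpmul2l tN0 h1.
  by rewrite muleA -!EFinM powRN mulVf ?gt_eqF// mul1e (mulrC (l * a)).
rewrite /lambda_scaled lebE.
have -> : l * a * power_mean (leb n) Omega a (fun x => `|u x|) r `^ (- p) =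
    l * a * t `^ (- p) * a `^ (p / q).
  rewrite -[RHS]mulrA; congr (_ * _).
  rewrite -[LHS]/((mean_pow r `^ r^-1) `^ (- p)) /t -powRrM.
  rewrite -[X in _ = X * _]powRrM powRM ?(ltW c0) ?(ltW a0)// -mulrA -powRD; last first.
    by rewrite (gt_eqF a0) implybT.
  rewrite (_ : _ + p / q = 0) ?powRr0 ?mulr1; last by field; rewrite gt_eqF.
  rewrite /c -powRrM; congr (_ `^ _); rewrite /r; field.
  by rewrite !gt_eqF.
by rewrite EFinM; apply: lee_wpmul2r => //; rewrite lee_fin powR_ge0.
Qed.

Lemma lambda_scaled_le (q : R) : 0 < q <= 1 ->
  (lambda_scaled q <=
   (l * a * (power_mean (leb n) Omega a (fun x => `|u x|) q) `^ (- p))%:E)%E.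
Proof.
move=> q01; have /andP[q0 q1] := q01.
have mq0 := mean_pow_gt0 q01.
pose s := (mean_pow q * a) `^ (- q^-1).
have s0 : 0 < s by apply: powR_gt0; exact: mulr_gt0.
have sq : s `^ q = (mean_pow q * a)^-1.
  by rewrite /s -powRrM mulNr mulVf ?gt_eqF// powR_inv1// ltW// mulr_gt0.
have intu : (\int[leb n]_(x in Omega) (`|u x| `^ q)%:E = (mean_pow q * a)%:E)%E.
  by rewrite (integral_EFin mO (ipow q01)) /mean_pow divfK// gt_eqF.
have lam : (lambda p Omega q <= (s `^ p * (l * a))%:E)%E.
  apply: ereal_inf_lbound; exists (fun x => s * u x), (fun x => s *: g x).
  split; first exact: W01pZ.
    rewrite -[LHS]/(int_pow q Omega (fun x => s * u x)) (int_powZ q mO s mu_) /int_pow intu.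
    by rewrite (gtr0_norm s0) sq -EFinM mulVf// gt_eqF// mulr_gt0.
  rewrite -int_pow_enorm (int_powZ_grad s0 Wu).
  by rewrite weak_solution_energy -EFinM.
rewrite /lambda_scaled lebE.
have -> : l * a * power_mean (leb n) Omega a (fun x => `|u x|) q `^ (- p) =
    s `^ p * (l * a) * a `^ (p / q).
  rewrite (mulrC (s `^ p)) -[RHS]mulrA; congr (_ * _).
  rewrite -[LHS]/((mean_pow q `^ q^-1) `^ (- p)) /s -powRrM.
  rewrite -[X in _ = X * _]powRrM (@powRM _ (mean_pow q) a _ (ltW mq0) (ltW a0))
    -mulrA -powRD; last first.
    by rewrite (gt_eqF a0) implybT.
  rewrite (_ : _ + p / q = 0) ?powRr0 ?mulr1; last by field; rewrite gt_eqF.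
  by congr (_ `^ _); field; rewrite gt_eqF.
by rewrite EFinM; apply: lee_wpmul2r => //; rewrite lee_fin powR_ge0.
Qed.

Let pm (q : R) := power_mean (leb n) Omega a (fun x => `|u x|) q.

Let cpm : pm q @[q --> 0^'+] --> geometric_mean Omega u.
Proof. by apply: (power_mean_cvg_geometric_mean p1 oO bO O0); exists g. Qed.

Let cpm_ratio : pm (q / (1 - q)) @[q --> 0^'+] --> geometric_mean Omega u.
Proof. exact: (cvg_comp _ _ cvg_ratio_at_right cpm). Qed.

Let la0 : 0 < l * a. Proof. exact: mulr_gt0. Qed.

Lemma mu_geometric_mean_gt0 : 0 < geometric_mean Omega u ->
  mu p Omega = (l * a * geometric_mean Omega u `^ (- p))%:E.
Proof.
move=> G0.
have cpow : {for geometric_mean Omega u, continuous (fun y : R => y `^ (- p))}.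
  apply: differentiable_continuous; apply/derivable1_diffP.
  by apply: derivable_powR; rewrite in_itv/= G0.
have scaled (h : R -> R) : h q @[q --> 0^'+] --> geometric_mean Omega u ->
    (l * a * h q `^ (- p))%:E @[q --> 0^'+] --> (l * a * geometric_mean Omega u `^ (- p))%:E.
  move=> ch; apply: cvg_EFin; first exact: nearW.
  exact: (cvgM (cvg_cst _) (continuous_cvg _ cpow ch)).
apply: cvg_lim => //.
apply: (@squeeze_cvge _ _ _ _ _ _ _ _ _ (scaled _ cpm_ratio) (scaled _ cpm)).
near=> q; apply/andP; split.
- apply: lambda_scaled_ge.
  by apply/andP; split => //; near: q; apply: nbhs_right_le; rewrite invr_gt0.
- apply: lambda_scaled_le.
  by apply/andP; split => //; near: q; exact: nbhs_right_le.
Unshelve. all: by end_near. Qed.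

(** The lower bound l |Omega| M_r^(-p) is unbounded when M_r tends to 0; e below
    is the size of M_r at which it reaches B >= A. *)
Lemma mu_geometric_mean_eq0 : geometric_mean Omega u = 0 -> mu p Omega = +oo%E.
Proof.
move=> G0; apply: cvg_lim => //; apply/cvgeyPge => A.
pose B := Num.max A 1.
have B0 : 0 < B by rewrite lt_max ltr01 orbT.
have [e e0 eB] : exists2 e : R, 0 < e & l * a * e `^ (- p) = B.
  have Bla : 0 < B / (l * a) by rewrite divr_gt0.
  exists ((B / (l * a)) `^ (- p^-1)); first exact: powR_gt0.
  rewrite -powRrM mulrNN mulVf ?gt_eqF// powRr1 ?(ltW Bla)//.
  by rewrite mulrC divfK// gt_eqF.
have small : \forall q \near 0^'+, pm (q / (1 - q)) < e.
  by apply: (cvgr_lt _ cpm_ratio); rewrite G0.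
near=> q.
have q2 : 0 < q <= 2^-1.
  by apply/andP; split => //; near: q; apply: nbhs_right_le; rewrite invr_gt0.
have r01 : 0 < q / (1 - q) <= 1.
  have /andP[q0 q12] := q2; have q1 : 0 < 1 - q by lra.
  by rewrite divr_gt0//= ler_pdivrMr//; lra.
have pm0 : 0 < pm (q / (1 - q)).
  by apply: powR_gt0; exact: (mean_pow_gt0 r01).
have pme : pm (q / (1 - q)) <= e by apply/ltW; near: q.
have AB : A <= B by rewrite le_max lexx.
have Bpm : B <= l * a * pm (q / (1 - q)) `^ (- p).
  rewrite -eB (ler_pM2l la0) !powRN; move: (pm _) pm0 pme => y y0 ye.
  have yp0 := powR_gt0 p y0; have ep0 := powR_gt0 p e0.
  rewrite lef_pV2 ?posrE//; apply: ge0_ler_powR => //; first exact: ltW.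
  - by rewrite nnegrE ltW.
  - by rewrite nnegrE ltW.
apply: le_trans (lambda_scaled_ge q2).
by rewrite lee_fin; exact: le_trans AB Bpm.
Unshelve. all: by end_near. Qed.

End weak_solution.

(** * The characterization of M(Omega) and the logarithm of the solution *)

Theorem corollary12 (R : realType) (N : nat) (p : R) (Omega : set 'rV[R]_N)
    (hN : (2 <= N)%N) (hp : 1 < p) (hOmega : smooth_bounded_domain Omega) :
  (forall v : 'rV[R]_N -> R, in_W01p p Omega v ->
     (calM p Omega v <-> int_log Omega v = 0%E)) /\
  (forall u : 'rV[R]_N -> R,
     weak_solution p Omega (fine (mu p Omega) / fine (leb N Omega)) u ->
     int_log Omega u = 0%E).
Proof.
have [oO _ O0 bO _] := hOmega.
split=> [v Wv|u [g [Wu uK eqn]]].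
  exact: iff_trans (calM_geometric_mean hp oO bO O0 Wv)
    (geometric_mean_eq1 hp oO bO O0 Wv).
have upos := ess_inf_on_pos_ae oO uK.
have mO := open_measurable_rV oO.
have leb0 := leb_open_gt0 oO O0.
set l := fine (mu p Omega) / _ in eqn.
set a := fine (leb N Omega) in l eqn.
have a0 : 0 < a by rewrite fine_gt0// leb0 leb_bounded_lty.
have muE : fine (mu p Omega) = l * a by rewrite divfK// gt_eqF.
have enE := weak_solution_energy hp oO bO Wu upos eqn.
(* The energy of u is l a, so l is nonnegative, and l = 0 would give grad u = 0. *)
have l0 : 0 < l.
  rewrite lt_neqAle eq_sym; apply/andP; split; last first.
    by rewrite -(pmulr_lge0 _ a0) -lee_fin -enE int_pow_ge0.
  apply/eqP => l0; rewrite l0 mul0r in enE.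
  have u0 := W01p_grad_eq0 hp oO bO (Ordinal (ltnW hN)) Wu enE.
  have [[Lu _ _] _] := Wu; have iu := in_Lp_integrable hp oO bO Lu.
  have mu_ := W01p_measurable hp oO Wu.
  have /eqP[] := ae_pos_integral_neq0 mO mu_ leb0 upos.
  rewrite (ae_eq_integral (EFin \o u))//.
  - by rewrite integral_EFin// u0.
  - by apply: measurableT_comp => //; exact/measurable_EFinP.
  - exact/measurable_EFinP.
  - by apply: filterS upos => x h Ox /=; rewrite gtr0_norm// h.
have Wu' : in_W01p p Omega u by exists g.
apply/(geometric_mean_eq1 hp oO bO O0 Wu').
have := geometric_mean_ge0 Omega u; rewrite le_eqVlt => /predU1P[G0|G0].
  have := mu_geometric_mean_eq0 hp oO bO Wu upos eqn l0 O0 (esym G0).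
  move=> muy; move: muE; rewrite muy/= => /eqP.
  by rewrite eq_sym gt_eqF// mulr_gt0.
have muG := mu_geometric_mean_gt0 hp oO bO Wu upos eqn l0 O0 G0.
have la0 := mulr_gt0 l0 a0.
have G1 : geometric_mean Omega u `^ (- p) = 1.
  apply: (mulfI (lt0r_neq0 la0)); rewrite mulr1.
  by have := congr1 fine muG; rewrite muE => /esym.
move/eqP: G1; rewrite powR_eq1 ltNge (ltW G0)/= oppr_eq0.
by rewrite (gt_eqF (lt_trans ltr01 hp)) orbF => /eqP.
Qed.
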